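(* For $k\ge1$ let $R(k)$ be the number of $(x,y,u,v)\in\mathbb{Z}^4$ with $k=x^2+xy+y^2+u^2+uv+v^2$, let $p_3(m)$ be the number of partitions of $m$ into parts congruent to $0\pmod 3$ (with $p_3(0)=1$ and $p_3(m)=0$ for $m<0$), and put $P_3(n)=\sum_{k=1}^{n}R(k)\,p_3(n-k)$. Then for every $n\ge1$, $\frac{1}{12}P_3(3n)$ and $\frac12N_2(n)$ are integers and $$spt_{2,3}(3n)\equiv \tfrac{1}{12}P_3(3n)-\tfrac{1}{2}N_2(n)\pmod 3.$$ Further, if $n\ge1$ and $n\equiv\pm1\pmod3$, then $spt_{2,3}(n)=\frac{1}{12}P_3(n)$.
   Context: $(a;q)_\infty=\prod_{k\ge0}(1-aq^k)$ and $(a;q)_n=\prod_{k=0}^{n-1}(1-aq^k)$. The function $spt_{2,3}(n)$ is defined by $$\sum_{n\ge1}spt_{2,3}(n)q^n=\sum_{n\ge1}\frac{q^n}{(1-q^n)\,(1-q^n)(1-q^{n+1})\cdots(1-q^{2n-1})\,(q^{3n};q^3)_{\infty}};$$ combinatorially, it is the total number of appearances of the smallest part $s$, summed over all partitions of $n$ in which every part other than $s$ is either strictly between $s$ and $2s$ or a multiple of $3$ that is at least $3s$. The rank of a partition is its largest part minus its number of parts; $N(m,n)$ is the number of partitions of $n$ with rank $m$, and $N_2(n)=\sum_{m\in\mathbb{Z}}m^2N(m,n)$. *)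

(* Defs.v *)
From HB Require Import structures.
From mathcomp Require Import all_boot all_order all_algebra.
From mathcomp Require Import zify ring lra.
From mathcomp Require Import finmap.
From mathcomp Require Import mathcomp_extra boolp classical_sets functions.
From mathcomp Require Import cardinality fsbigop.

Set Implicit Arguments.
Unset Strict Implicit.
Unset Printing Implicit Defensive.

Import Order.TTheory GRing.Theory Num.Theory.

Local Open Scope classical_set_scope.
Local Open Scope ring_scope.

(* A separate record, since [nat -> R] already carries the pointwise ring
   structure. *)
Record fps (R : comUnitRingType) := Fps { fcoef : nat -> R }.

Section FormalPowerSeries.
Variable R : comUnitRingType.
Implicit Types f g h : fps R.

Lemma fpsP f g : (forall n, fcoef f n = fcoef g n) -> f = g.
Proof. by case: f g => [f] [g] /= /funext ->. Qed.

HB.instance Definition _ := gen_eqMixin (fps R).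
HB.instance Definition _ := gen_choiceMixin (fps R).

Definition fps_zero : fps R := Fps (fun=> 0).
Definition fps_opp f := Fps (fun n => - fcoef f n).
Definition fps_add f g := Fps (fun n => fcoef f n + fcoef g n).

Fact fps_addA : associative fps_add.
Proof. by move=> f g h; apply: fpsP => n /=; rewrite addrA. Qed.
Fact fps_addC : commutative fps_add.
Proof. by move=> f g; apply: fpsP => n /=; rewrite addrC. Qed.
Fact fps_add0 : left_id fps_zero fps_add.
Proof. by move=> f; apply: fpsP => n /=; rewrite add0r. Qed.
Fact fps_addN : left_inverse fps_zero fps_opp fps_add.
Proof. by move=> f; apply: fpsP => n /=; rewrite addNr. Qed.

HB.instance Definition _ :=
  GRing.isZmodule.Build (fps R) fps_addA fps_addC fps_add0 fps_addN.

Definition fpsC (c : R) : fps R := Fps (fun n => if n == 0%N then c else 0).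
Definition fps_mul f g :=
  Fps (fun n => \sum_(i < n.+1) fcoef f i * fcoef g (n - i)%N).

Definition fps_trunc m f : {poly R} := \poly_(i < m) fcoef f i.

Fact fcoef_mul_trunc m n f g (p q : {poly R}) : (n < m)%N ->
    (forall i, (i < m)%N -> p`_i = fcoef f i) ->
    (forall i, (i < m)%N -> q`_i = fcoef g i) ->
  fcoef (fps_mul f g) n = (p * q)`_n.
Proof.
move=> nm pf qg; rewrite coefM /=; apply: eq_bigr => i _.
by rewrite pf ?qg //; have := ltn_ord i; lia.
Qed.

Fact coef_trunc m f i : (i < m)%N -> (fps_trunc m f)`_i = fcoef f i.
Proof. by rewrite coef_poly => ->. Qed.

Fact fps_mulA : associative fps_mul.
Proof.
move=> f g h; apply: fpsP => n.
pose t := fps_trunc n.+1; have tP := @coef_trunc n.+1.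
rewrite (@fcoef_mul_trunc n.+1 _ _ _ (t f) (t g * t h)) //; last 2 first.
- exact: tP.
- by move=> i im; rewrite (@fcoef_mul_trunc n.+1 i _ _ (t g) (t h)) //; exact: tP.
rewrite (@fcoef_mul_trunc n.+1 _ _ _ (t f * t g) (t h)) ?mulrA //; last exact: tP.
by move=> i im; rewrite (@fcoef_mul_trunc n.+1 i _ _ (t f) (t g)) //; exact: tP.
Qed.

Fact fps_mulC : commutative fps_mul.
Proof.
move=> f g; apply: fpsP => n; have tP := @coef_trunc n.+1.
rewrite (@fcoef_mul_trunc n.+1 _ _ _ _ _ (ltnSn n) (tP f) (tP g)) mulrC.
by rewrite (@fcoef_mul_trunc n.+1 _ _ _ _ _ (ltnSn n) (tP g) (tP f)).
Qed.

Fact fps_mul1 : left_id (fpsC 1) fps_mul.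
Proof.
move=> f; apply: fpsP => n /=.
rewrite big_ord_recl /= mul1r subn0 big1 ?addr0 // => i _.
by rewrite mul0r.
Qed.

Fact fps_mulDl : left_distributive fps_mul fps_add.
Proof.
move=> f g h; apply: fpsP => n /=; rewrite -big_split /=.
by apply: eq_bigr => i _; rewrite mulrDl.
Qed.

Fact fps_one_neq0 : fpsC 1 != 0.
Proof.
by apply/eqP => /(congr1 (fun f => fcoef f 0)) /eqP; rewrite /= oner_eq0.
Qed.

HB.instance Definition _ := GRing.Zmodule_isComNzRing.Build (fps R)
  fps_mulA fps_mulC fps_mul1 fps_mulDl fps_one_neq0.

Lemma fcoef0 n : fcoef (0 : fps R) n = 0. Proof. by []. Qed.
Lemma fcoef1 n : fcoef (1 : fps R) n = (n == 0%N)%:R.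
Proof. by rewrite /=; case: eqP. Qed.
Lemma fcoefD f g n : fcoef (f + g) n = fcoef f n + fcoef g n.
Proof. by []. Qed.
Lemma fcoefN f n : fcoef (- f) n = - fcoef f n. Proof. by []. Qed.
Lemma fcoefM f g n :
  fcoef (f * g) n = \sum_(i < n.+1) fcoef f i * fcoef g (n - i)%N.
Proof. by []. Qed.
Lemma fcoefCM c f n : fcoef (fpsC c * f) n = c * fcoef f n.
Proof.
rewrite fcoefM big_ord_recl /= subn0 big1 ?addr0 // => i _.
by rewrite mul0r.
Qed.
Lemma fcoef_sum (I : Type) (r : seq I) (P : pred I) (F : I -> fps R) n :
  fcoef (\sum_(i <- r | P i) F i) n = \sum_(i <- r | P i) fcoef (F i) n.
Proof. by elim/big_rec2: _ => // i f1 f2 _ <-. Qed.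

Lemma fcoefX_small f j k : fcoef f 0 = 0 -> (k < j)%N -> fcoef (f ^+ j) k = 0.
Proof.
move=> f0; elim: j k => [//|j IH] k kj.
rewrite exprS fcoefM big_ord_recl f0 mul0r add0r big1 // => i _.
by rewrite IH ?mulr0 // /lift /= /bump /=; have := ltn_ord i; lia.
Qed.

Definition fps_unit : {pred fps R} :=
  [pred f : fps R | fcoef f 0 \is a GRing.unit].

(* [1 / f = u * \sum_(j >= 0) (1 - u * f) ^+ j] with [u = (fcoef f 0)^-1]; the
   terms with [n < j] do not contribute to the coefficient of index [n]. *)
Definition fps_inv (f : fps R) : fps R :=
  if f \in fps_unit then
    let u := (fcoef f 0)^-1 in
    Fps (fun n => u * fcoef (\sum_(j < n.+1) (1 - fpsC u * f) ^+ j) n)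
  else f.

Fact fps_mulV : {in fps_unit, left_inverse 1 fps_inv *%R}.
Proof.
move=> f fU; rewrite /fps_inv fU /=; set u := (fcoef f 0)^-1.
pose g := 1 - fpsC u * f.
have g0 : fcoef g 0 = 0.
  by rewrite fcoefD fcoefN fcoefCM fcoef1 mulVr ?subrr.
pose S n := \sum_(j < n.+1) g ^+ j.
pose T := Fps (fun n => fcoef (S n) n).
have ST n k : (k <= n)%N -> fcoef T k = fcoef (S n) k.
  move=> kn; rewrite /T /= /S !fcoef_sum.
  rewrite (big_ord_widen n.+1 (fun j => fcoef (g ^+ j) k)) //.
  rewrite big_mkcond /=; apply: eq_bigr => j _.
  by case: ltnP => // kj; rewrite fcoefX_small.
have -> : Fps (fun n => u * fcoef (S n) n) = fpsC u * T.
  by apply: fpsP => n; rewrite fcoefCM.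
have -> : fpsC u * T * f = (1 - g) * T.
  by rewrite /g opprB addrCA subrr addr0 mulrAC.
apply: fpsP => n.
have -> : fcoef ((1 - g) * T) n = fcoef ((1 - g) * S n) n.
  rewrite !fcoefM; apply: eq_bigr => i _.
  by rewrite (ST n) //; have := ltn_ord i; lia.
have -> : (1 - g) * S n = 1 - g ^+ n.+1.
  by rewrite -opprB -[in RHS]opprB subrX1 mulNr.
by rewrite fcoefD fcoefN fcoefX_small // subr0.
Qed.

Fact fps_unitPl f g : g * f = 1 -> f \in fps_unit.
Proof.
move=> /(congr1 (fun h => fcoef h 0)).
rewrite fcoefM big_ord1 fcoef1 subn0 /= => gf.
by apply/unitrPr; exists (fcoef g 0); rewrite mulrC.
Qed.

Fact fps_inv_out : {in [predC fps_unit], fps_inv =1 id}.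
Proof. by move=> f; rewrite inE /= /fps_inv => /negPf ->. Qed.

HB.instance Definition _ := GRing.ComNzRing_hasMulInverse.Build (fps R)
  fps_mulV fps_unitPl fps_inv_out.

Definition fpsX : fps R := Fps (fun n => (n == 1%N)%:R).

Definition qpoch (a q : fps R) (n : nat) : fps R :=
  \prod_(0 <= k < n) (1 - a * q ^+ k).

(* The infinite product, for [q] without constant term: the factors with
   [n < k] do not contribute to the coefficient of index [n]; see
   [fcoef_qpoch_inf]. *)
Definition qpoch_inf (a q : fps R) : fps R :=
  Fps (fun n => fcoef (qpoch a q n.+1) n).

(* The sum of [F n] over [n >= 1], for [F n] without terms of degree less than
   [n]; see [fcoef_fps_sum]. *)
Definition fps_sum (F : nat -> fps R) : fps R :=
  Fps (fun N => fcoef (\sum_(1 <= n < N.+1) F n) N).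

Lemma fcoef_qpoch_inf a q n m : fcoef q 0 = 0 -> (n < m)%N ->
  fcoef (qpoch_inf a q) n = fcoef (qpoch a q m) n.
Proof.
move=> q0; elim: m => // m IH; rewrite ltnS leq_eqVlt => /predU1P[-> //|nm].
have -> : qpoch a q m.+1 = qpoch a q m * (1 - a * q ^+ m).
  by rewrite /qpoch big_nat_recr.
rewrite IH // mulrBr mulr1 fcoefD fcoefN mulrA.
rewrite [X in _ = _ - X]fcoefM big1 ?subr0 // => i _.
by rewrite fcoefX_small ?mulr0 //; lia.
Qed.

Lemma fcoef_fps_sum (F : nat -> fps R) N M :
    (forall n k, (k < n)%N -> fcoef (F n) k = 0) -> (N <= M)%N ->
  fcoef (fps_sum F) N = fcoef (\sum_(1 <= n < M.+1) F n) N.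
Proof.
move=> F0 NM; have -> : \sum_(1 <= n < M.+1) F n =
    \sum_(1 <= n < N.+1) F n + \sum_(N.+1 <= n < M.+1) F n.
  by rewrite -big_cat_nat.
rewrite fcoefD [X in _ = _ + X](_ : _ = 0) ?addr0 //.
rewrite fcoef_sum big_nat_cond big1 //.
by move=> n /andP[/andP[+ _] _]; exact: F0.
Qed.

End FormalPowerSeries.

Arguments fpsX {R}.

(* Division is ring division, which is only meaningful when the denominator has
   an invertible constant term; see [spt23_den_unit]. *)
Definition spt23_den (n : nat) : fps int :=
  let q := fpsX in
  (1 - q ^+ n) * \prod_(n <= i < 2 * n) (1 - q ^+ i)
  * qpoch_inf (q ^+ (3 * n)) (q ^+ 3).

Definition spt23_gf : fps int := fps_sum (fun n => fpsX ^+ n / spt23_den n).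

Definition spt23 (n : nat) : int := fcoef spt23_gf n.

Lemma spt23_den_unit n : (0 < n)%N -> spt23_den n \is a GRing.unit.
Proof.
move=> n0; rewrite /spt23_den.
have X0 m : (0 < m)%N -> fcoef (fpsX ^+ m : fps int) 0 = 0.
  by move=> m0; rewrite fcoefX_small.
have U m : (0 < m)%N -> (1 - fpsX ^+ m : fps int) \is a GRing.unit.
  move=> m0; suff: fcoef (1 - fpsX ^+ m : fps int) 0 \is a GRing.unit by [].
  by rewrite fcoefD fcoefN X0 // subr0.
rewrite !unitrM U //=; apply/andP; split.
  rewrite big_nat_cond; elim/big_ind: _ => [|f g fU gU|i /andP[/andP[ni _] _]].
  - exact: unitr1.
  - by rewrite unitrM fU.
  - by apply: U; lia.
set f := qpoch_inf _ _; suff: fcoef f 0 \is a GRing.unit by [].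
have -> : fcoef f 0 = fcoef (1 - fpsX ^+ (3 * n) : fps int) 0.
  by rewrite /f /qpoch_inf /qpoch [fcoef (Fps _) _]/fcoef big_nat1 expr0 mulr1.
by apply: U; lia.
Qed.

Lemma fcoef_spt23_term n k : (k < n)%N ->
  fcoef (fpsX ^+ n / spt23_den n) k = 0.
Proof.
move=> kn; rewrite fcoefM big1 // => i _.
by rewrite fcoefX_small ?mul0r //; have := ltn_ord i; lia.
Qed.

Definition is_partition (n : nat) (s : seq nat) : bool :=
  [&& sorted geq s, all (ltn 0) s & sumn s == n].

Definition partition_rank (s : seq nat) : int :=
  (\max_(i <- s) i)%N%:Z - (size s)%:Z.

(* [fset_set] of an infinite set is empty; the sets below are finite, see
   [finite_partitions] and [finite_quadruples]. *)
Definition Nrank (m : int) (n : nat) : nat :=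
  #|` fset_set [set s | is_partition n s /\ partition_rank s = m]|.

Definition N2 (n : nat) : int := \sum_(m \in [set: int]) m ^+ 2 * (Nrank m n)%:Z.

Definition R4 (k : nat) : nat :=
  #|` fset_set [set t : int * int * int * int |
      let: (x, y, u, v) := t in
      k%:Z = x ^+ 2 + x * y + y ^+ 2 + u ^+ 2 + u * v + v ^+ 2]|.

Definition p3 (m : nat) : nat :=
  #|` fset_set [set s | is_partition m s /\ all (dvdn 3) s]|.

Definition P3 (n : nat) : nat := (\sum_(1 <= k < n.+1) R4 k * p3 (n - k))%N.

Lemma finite_partitions n : finite_set [set s | is_partition n s].
Proof.
pose B : set (seq nat) :=
  [set [seq val i | i <- val t] | t in [set: n.-bseq 'I_n.+1]].
apply: (@sub_finite_set _ _ B); last exact/finite_image/finite_finset.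
move=> s /and3P[_ s0 /eqP sn].
have ssz : (size s <= n)%N.
  rewrite -sn; elim: s s0 {sn} => //= x s IH /andP[x0 /IH]; lia.
have sb : all (fun x => (x < n.+1)%N) s.
  apply/allP => x xs; rewrite ltnS -sn sumnE.
  by rewrite (big_rem x) //= leq_addr.
have sE : [seq val i | i <- [seq (inord x : 'I_n.+1) | x <- s]] = s.
  rewrite -map_comp; apply: map_id_in => x xs /=.
  by rewrite inordK //; exact: (allP sb).
have tn : (size [seq (inord x : 'I_n.+1) | x <- s] <= n)%N by rewrite size_map.
by exists (Bseq tn).
Qed.

Lemma finite_quadruples (k : nat) : finite_set [set t : int * int * int * int |
  let: (x, y, u, v) := t in
  k%:Z = x ^+ 2 + x * y + y ^+ 2 + u ^+ 2 + u * v + v ^+ 2].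
Proof.
pose c (i : 'I_(4 * k).+1) : int := i%:Z - (2 * k)%N%:Z.
pose B : set (int * int * int * int) :=
  [set (c t.1.1.1, c t.1.1.2, c t.1.2, c t.2) |
     t in [set: 'I_(4 * k).+1 * 'I_(4 * k).+1 * 'I_(4 * k).+1 * 'I_(4 * k).+1]].
apply: (@sub_finite_set _ _ B); last exact/finite_image/finite_finset.
have bnd (x y : int) : x ^+ 2 + x * y + y ^+ 2 <= k%:Z ->
    (exists i, c i = x) /\ (exists i, c i = y).
  move=> H.
  have aux (z : int) : - (2 * k)%N%:Z <= z <= (2 * k)%N%:Z -> exists i, c i = z.
    move=> zk; have lt : (`|(z + (2 * k)%N%:Z)%R| < (4 * k).+1)%N by lia.
    by exists (Ordinal lt); rewrite /c /=; lia.
  have x2 : 3 * x ^+ 2 <= 4 * k%:Z by have := sqr_ge0 (x + 2%:Z * y); nra.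
  have y2 : 3 * y ^+ 2 <= 4 * k%:Z by have := sqr_ge0 (y + 2%:Z * x); nra.
  have abs2 (z : int) : - z ^+ 2 <= z <= z ^+ 2.
    have [z0|z0] : z <= 0 \/ 1 <= z by lia.
      have [z1|->] : z <= - 1 \/ z = 0 by lia.
        by apply/andP; split; nra.
      by [].
    by apply/andP; split; nra.
  by split; apply: aux; [have := abs2 x|have := abs2 y]; lia.
move=> [[[x y] u] v] /= kE.
have nn (a b : int) : 0 <= a ^+ 2 + a * b + b ^+ 2.
  by have := sqr_ge0 (a + b); have := sqr_ge0 a; have := sqr_ge0 b; nra.
have [|[i <-] [j <-]] := bnd x y; first by have := nn u v; lia.
have [|[i' <-] [j' <-]] := bnd u v; first by have := nn x y; lia.
by exists (i, j, i', j').
Qed.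

Lemma Nrank_eq0 (m : int) (n : nat) : (n < `|m|)%N -> Nrank m n = 0%N.
Proof.
move=> nm; rewrite /Nrank; suff -> : [set s | is_partition n s /\
  partition_rank s = m] = set0 by rewrite fset_set0.
rewrite -subset0 => s [/and3P[_ s0 /eqP sn] sm] /=.
have ssz : (size s <= n)%N.
  by rewrite -sn; elim: s s0 {sn sm} => //= x s IH /andP[x0 /IH]; lia.
have sb : (\max_(i <- s) i <= n)%N.
  apply/bigmax_leqP_seq => x xs _.
  by rewrite -sn sumnE (big_rem x) //= leq_addr.
move: sm; rewrite /partition_rank; lia.
Qed.

Lemma finite_support_N2 n :
  finite_set [set m : int | m ^+ 2 * (Nrank m n)%:Z != 0].
Proof.
pose c (i : 'I_(2 * n).+1) : int := i%:Z - n%:Z.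
apply: (@sub_finite_set _ _ (c @` [set: 'I_(2 * n).+1])); last first.
  exact/finite_image/finite_finset.
move=> m /= m0; have [mn|/Nrank_eq0 m0'] := leqP `|m|%N n; last first.
  by rewrite m0' mulr0 eqxx in m0.
have lt : (`|(m + n%:Z)%R| < (2 * n).+1)%N by lia.
by exists (Ordinal lt) => //; rewrite /c /=; lia.
Qed.

(* Main.v *)
(* Write (q)_n for (q; q)_n and x for a primitive cube root of unity.

   The pair with beta_n proportional to (1 + q^n) (x; q)_n (1 / x; q)_n / (q)_2n
   has alpha_r = (-1)^r q^(r (r - 1) / 2) (1 + q^r) (x^r + x^-r), and the
   Bailey-type sum of q^n (q)_(n-1)^2 / ((q)_(n-r) (q)_(n+r)) over n telescopes.
   As (x q; q)_n (q / x; q)_n = (q^3; q^3)_n / (q)_n, this gives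
     (q^3; q^3)_oo * sum_n spt_{2,3}(n) q^n = sum_n sigma(n) q^n + T(q^3),
     T(q) = sum_m (-1)^m q^(m (3 m + 1) / 2) (1 + q^m) / (1 - q^m)^2.

   Dyson's adjoint symmetry says that there are as many partitions of n of rank
   at least m as partitions of n - m - 1 of rank at most m + 2.  Iterating it,
   and summing m^2 by parts, yields (q)_oo * sum_n (N_2(n) / 2) q^n = - T(q).

   In the Eisenstein integers, the number r(n) of elements of norm n satisfies
   r(p n) = (1 + chi(p)) r(n) - chi(p) r(n / p) for every prime p, where chi is
   the character modulo 3; hence r(n) is 6 times the sum of chi over the
   divisors of n.  Ramanujan's squaring of Lambert series then gives
   R(k) = 12 (sigma(k) - 3 sigma(k / 3)).

   Hence the generating functions of spt_{2,3} and P_3 / 12 differ by a power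
   series in q^3, which modulo 3 is that of - N_2 / 2. *)

Require Import Defs.
From HB Require Import structures.
From mathcomp Require Import all_boot all_order all_algebra.
From mathcomp Require Import zify ring lra.
From mathcomp Require Import finfield finmap.
From mathcomp Require Import mathcomp_extra boolp classical_sets functions.
From mathcomp Require Import cardinality fsbigop.

Set Implicit Arguments.
Unset Strict Implicit.
Unset Printing Implicit Defensive.

Import Order.TTheory GRing.Theory Num.Theory.
Local Open Scope ring_scope.

(** * Truncated power series and Gaussian binomials *)

Local Notation q := (fpsX : fps int).

Fact fpsC_additive : zmod_morphism (@fpsC int).
Proof.
move=> a b; apply: fpsP => k; rewrite fcoefD fcoefN /=.
by case: eqP; rewrite ?subr0.
Qed.

Fact fpsC_multiplicative : monoid_morphism (@fpsC int).
Proof.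
split=> // a b; apply: fpsP => k; rewrite fcoefCM /=.
by case: eqP; rewrite ?mulr0.
Qed.

HB.instance Definition _ :=
  GRing.isZmodMorphism.Build _ _ (@fpsC int) fpsC_additive.
HB.instance Definition _ :=
  GRing.isMonoidMorphism.Build _ _ (@fpsC int) fpsC_multiplicative.

Lemma fpsC_nat n : fpsC n%:Z = n%:R :> fps int.
Proof. by rewrite -[n%:Z]natz rmorph_nat. Qed.

(** Congruence modulo q^(N+1): infinite sums and products are compared through their truncations. *)
Definition eqX (N : nat) (f g : fps int) :=
  forall k, (k <= N)%N -> fcoef f k = fcoef g k.

Lemma eqX_refl N f : eqX N f f. Proof. by []. Qed.
#[local] Hint Resolve eqX_refl : core.

Lemma eqX_sym N f g : eqX N f g -> eqX N g f.
Proof. by move=> h k kN; rewrite h. Qed.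

Lemma eqX_trans N f g h : eqX N f g -> eqX N g h -> eqX N f h.
Proof. by move=> fg gh k kN; rewrite fg // gh. Qed.

Lemma eqXD N f f' g g' : eqX N f f' -> eqX N g g' -> eqX N (f + g) (f' + g').
Proof. by move=> e1 e2 k kN; rewrite !fcoefD e1 // e2. Qed.

Lemma eqXN N f f' : eqX N f f' -> eqX N (- f) (- f').
Proof. by move=> e1 k kN; rewrite !fcoefN e1. Qed.

Lemma eqXB N f f' g g' : eqX N f f' -> eqX N g g' -> eqX N (f - g) (f' - g').
Proof. by move=> e1 e2; apply: eqXD => //; apply: eqXN. Qed.

Lemma eqXM N f f' g g' : eqX N f f' -> eqX N g g' -> eqX N (f * g) (f' * g').
Proof.
move=> e1 e2 k kN; rewrite !fcoefM; apply: eq_bigr => i _.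
by rewrite e1 ?e2 //; have := ltn_ord i; lia.
Qed.

Lemma eqX_sum N (I : eqType) (r : seq I) (P : pred I) (F G : I -> fps int) :
  (forall i, i \in r -> P i -> eqX N (F i) (G i)) ->
  eqX N (\sum_(i <- r | P i) F i) (\sum_(i <- r | P i) G i).
Proof.
move=> h k kN; rewrite !fcoef_sum big_seq_cond [RHS]big_seq_cond.
by apply: eq_bigr => i /andP[ir Pi]; apply: h.
Qed.

Lemma fcoef_Xn n k : fcoef (q ^+ n) k = (k == n)%:R.
Proof.
elim: n k => [|n IH] k; first by rewrite expr0 fcoef1.
rewrite exprS fcoefM; case: k => [|k].
  by rewrite big_ord1 /= mul0r.
rewrite 2!big_ord_recl big1 /= ?mul0r ?add0r ?addr0 => [|i _];
  last by rewrite mul0r.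
by rewrite /lift /bump /= mul1r subSS subn0 IH eqSS.
Qed.

Lemma fcoef_XnM n f k :
  fcoef (q ^+ n * f) k = if (n <= k)%N then fcoef f (k - n) else 0.
Proof.
rewrite fcoefM; case: leqP => nk; last first.
  apply: big1 => i _; rewrite fcoef_Xn (_ : _ == _ = false) ?mul0r //.
  by apply/eqP; have := ltn_ord i; lia.
have nk1 : (n < k.+1)%N by [].
rewrite (bigD1 (Ordinal nk1)) //= fcoef_Xn eqxx mul1r big1 ?addr0 // => i.
by rewrite fcoef_Xn -val_eqE /= => /negPf ->; rewrite mul0r.
Qed.

Lemma eqX_XnM0 N n f : (N < n)%N -> eqX N (q ^+ n * f) 0.
Proof. by move=> Nn k kN; rewrite fcoef_XnM leqNgt (leq_ltn_trans kN Nn). Qed.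

Lemma eqX_XnM N M n f g : (N <= M + n)%N -> eqX M f g ->
  eqX N (q ^+ n * f) (q ^+ n * g).
Proof.
move=> NM fg k kN; rewrite !fcoef_XnM; case: leqP => // nk.
by apply: fg; lia.
Qed.

Lemma unit_1X n : (0 < n)%N -> 1 - q ^+ n \is a GRing.unit.
Proof.
move=> n0; suff: fcoef (1 - q ^+ n) 0 \is a GRing.unit by [].
by rewrite fcoefD fcoefN fcoef_Xn fcoef1; case: n n0.
Qed.

Definition qf (n : nat) : fps int := \prod_(i < n) (1 - q ^+ i.+1).

Lemma qf0 : qf 0 = 1. Proof. by rewrite /qf big_ord0. Qed.
Lemma qfS n : qf n.+1 = qf n * (1 - q ^+ n.+1).
Proof. by rewrite /qf big_ord_recr. Qed.

Lemma qf_unit n : qf n \is a GRing.unit.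
Proof.
by elim: n => [|n IH]; rewrite ?qf0 ?unitr1 // qfS unitrM IH unit_1X.
Qed.

(** Thus every [qf n] with N <= n represents (q)_oo modulo q^(N+1). *)
Lemma eqX_qf N n m : (N <= n)%N -> (n <= m)%N -> eqX N (qf m) (qf n).
Proof.
move=> Nn nm; rewrite -(subnK nm); elim: (m - n)%N => [//|k IH].
rewrite addSn qfS mulrBr mulr1 -[X in eqX _ _ X]subr0 mulrC.
by apply: eqXB => //; rewrite mulrC [qf _ * _]mulrC; apply: eqX_XnM0; lia.
Qed.

Lemma eqX_mulI N f g h : h \is a GRing.unit -> eqX N (h * f) (h * g) -> eqX N f g.
Proof.
move=> hU e; have := @eqXM N h^-1 h^-1 _ _ (eqX_refl _) e.
by rewrite !mulrA mulVr // !mul1r.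
Qed.

(* The Gaussian binomial coefficient [a + b choose a]. *)
Fixpoint gauss (a : nat) : nat -> fps int :=
  if a is a'.+1 then
    fix gauss_a b := if b is b'.+1 then gauss a' b + q ^+ a * gauss_a b' else 1
  else fun=> 1.

Lemma gauss0n b : gauss 0 b = 1. Proof. by []. Qed.
Lemma gaussn0 a : gauss a 0 = 1. Proof. by case: a. Qed.
Lemma gaussSS a b :
  gauss a.+1 b.+1 = gauss a b.+1 + q ^+ a.+1 * gauss a.+1 b.
Proof. by []. Qed.

(** The mirror q-Pascal rule, from which the symmetry [gaussC] follows. *)
Lemma gaussSS' a b :
  gauss a.+1 b.+1 = gauss a.+1 b + q ^+ b.+1 * gauss a b.+1.
Proof.
elim: a b => [|a IHa] b.
  rewrite gauss0n mulr1; elim: b => [|b IH];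
    first by rewrite gaussSS !gaussn0 mulr1.
  by rewrite gaussSS {1}IH [in RHS]gaussSS !gauss0n mulrDr addrA expr1 -exprS.
elim: b => [|b IHb].
  by rewrite gaussSS [in LHS]IHa [in RHS]gaussSS !gaussn0 !exprS; ring.
rewrite [LHS]gaussSS [in LHS]IHa [in LHS]IHb [in RHS]gaussSS.
rewrite [gauss a.+1 b.+2 in RHS]gaussSS.
by rewrite !exprS; ring.
Qed.

Lemma gaussC a b : gauss a b = gauss b a.
Proof.
elim: a b => [|a IHa] b; first by rewrite gaussn0.
elim: b => [|b IHb]; first by rewrite gaussn0.
by rewrite gaussSS IHa IHb -gaussSS'.
Qed.

(** The two q-Pascal terms combine by (1 - q^(a+1)) + q^(a+1) (1 - q^(b+1)) = 1 - q^(a+b+2). *)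
Lemma gauss_qf a b : gauss a b * (qf a * qf b) = qf (a + b).
Proof.
elim: a b => [|a IHa] b; first by rewrite gauss0n qf0 !mul1r.
elim: b => [|b IHb]; first by rewrite gaussn0 qf0 addn0 mulr1 mul1r.
have e1 := IHa b.+1; have e2 := IHb; rewrite addSnnS in e2.
rewrite gaussSS [in RHS]addSn [in RHS]qfS -[(a + b.+1).+1]addSn.
transitivity (gauss a b.+1 * (qf a * qf b.+1) * (1 - q ^+ a.+1)
   + q ^+ a.+1 * (gauss a.+1 b * (qf a.+1 * qf b)) * (1 - q ^+ b.+1)).
  by rewrite !qfS; ring.
by rewrite e1 e2 exprD; ring.
Qed.

Lemma gauss_divE a b : gauss a b / qf (a + b) = (qf a * qf b)^-1.
Proof.
have U : qf a * qf b \is a GRing.unit by rewrite unitrM !qf_unit.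
apply: (mulIr (qf_unit (a + b))); rewrite divrK ?qf_unit //.
by rewrite -gauss_qf mulrCA mulVr // mulr1.
Qed.

(** * The finite triple product at cube roots of unity *)

(* r (r - 1) / 2 *)
Definition triz (r : int) : nat :=
  match r with Posz n => 'C(n, 2) | Negz n => 'C(n.+2, 2) end.

Lemma trizD1 r : (triz (r + 1))%:Z = (triz r)%:Z + r.
Proof.
case: r => [n|[|n]].
- have -> : n%:Z + 1 = n.+1 by lia.
  by rewrite /= binS bin1 PoszD.
- by [].
- have -> : Negz n.+1 + 1 = Negz n by lia.
  by rewrite /= [in RHS]binS bin1 NegzE; lia.
Qed.

Lemma trizN r : (triz (- r))%:Z = (triz r)%:Z + r.
Proof.
case: r => [[|n]|n] //.
- by rewrite -NegzE /= binS bin1; lia.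
- by rewrite NegzE opprK /= [in RHS]binS bin1; lia.
Qed.

(** The coefficient of x^r in Jacobi's product (x; q)_oo (q/x; q)_oo (q; q)_oo. *)
Definition theta_coef (r : int) : fps int := (-1) ^+ `|r|%N * q ^+ triz r.

(** Raising r by 1 multiplies the coefficient by - q^r; the power q^a keeps the exponents natural
    when r is negative. *)
Lemma theta_coefD1 (a : nat) (r : int) : r <= a%:Z ->
  q ^+ a * theta_coef r = - (q ^+ `|(a%:Z - r)%R|%N * theta_coef (r + 1)).
Proof.
move=> ra; rewrite /theta_coef.
have -> : (-1) ^+ `|(r + 1)%R|%N = - (-1) ^+ `|r|%N :> fps int.
  have [r0|r0] := leP 0 r.
    by rewrite (_ : `|(r + 1)%R| = `|r|.+1)%N ?exprS ?mulN1r //; lia.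
  by rewrite (_ : `|r| = `|(r + 1)%R|.+1)%N ?exprS ?mulN1r ?opprK //; lia.
rewrite mulNr mulrN opprK !(mulrCA (q ^+ _)) -!exprD; congr (_ * _ ^+ _).
by have := trizD1 r; move: (triz _) (triz _); lia.
Qed.

Lemma theta_coefB1 (b : nat) (r : int) : - (b%:Z + 1) <= r - 1 ->
  q ^+ b.+1 * theta_coef r = - (q ^+ `|(b%:Z + r)%R|%N * theta_coef (r - 1)).
Proof.
move=> rb; rewrite /theta_coef.
have -> : (-1) ^+ `|(r - 1)%R|%N = - (-1) ^+ `|r|%N :> fps int.
  have [r0|r0] := leP 1 r.
    by rewrite (_ : `|r| = `|(r - 1)%R|.+1)%N ?exprS ?mulN1r ?opprK //; lia.
  by rewrite (_ : `|(r - 1)%R| = `|r|.+1)%N ?exprS ?mulN1r //; lia.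
rewrite mulNr mulrN opprK !(mulrCA (q ^+ _)) -!exprD; congr (_ * _ ^+ _).
by have := trizD1 (r - 1); rewrite subrK; move: (triz _) (triz _); lia.
Qed.

(** The q-Pascal rule along a row; the conditionals supply the value 0 outside 0 <= j <= n. *)
Lemma gauss_split n j : (j <= n.+1)%N ->
  gauss (n.+1 - j) j = (if (j <= n)%N then gauss (n - j) j else 0) +
    (if j is j'.+1 then q ^+ (n - j') * gauss (n - j') j' else 0).
Proof.
case: j => [_|j]; first by rewrite !gaussn0 addr0.
rewrite ltnS subSS leq_eqVlt => /predU1P[->|jn].
  by rewrite ltnn subnn add0r !gauss0n mulr1.
have -> : (n - j)%N = (n - j.+1).+1 by lia.
by rewrite jn gaussSS.
Qed.

Lemma gauss_split' n j : (j <= n.+1)%N ->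
  gauss (n.+1 - j) j = (if (j <= n)%N then q ^+ j * gauss (n - j) j else 0) +
    (if j is j'.+1 then gauss (n - j') j' else 0).
Proof.
case: j => [_|j]; first by rewrite !gaussn0 addr0 mul1r.
rewrite ltnS subSS leq_eqVlt => /predU1P[->|jn].
  by rewrite ltnn subnn add0r !gauss0n.
have -> : (n - j)%N = (n - j.+1).+1 by lia.
by rewrite jn gaussSS' addrC.
Qed.

(* The value at [x ^+ r := c r] of the finite triple product
   [\prod_(k < a) (1 - x * q ^+ k) * \prod_(k < b) (1 - q ^+ k.+1 / x)]. *)
Definition ftheta (a b : nat) (c : int -> fps int) : fps int :=
  \sum_(j < (a + b).+1)
    gauss (a + b - j) j * theta_coef (j%:Z - b%:Z) * c (j%:Z - b%:Z).

(** Multiplication by the new factor 1 - x q^a, where x acts by shifting the argument of [c].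
    Likewise [fthetaSr] multiplies by 1 - q^(b+1) / x. *)
Lemma fthetaSl a b c :
  ftheta a.+1 b c = ftheta a b c - q ^+ a * ftheta a b (fun r => c (r + 1)).
Proof.
rewrite /ftheta !addSn mulr_sumr -sumrN.
under eq_bigr => j _ do rewrite gauss_split -1?ltnS // mulrDl mulrDl.
rewrite big_split /= big_ord_recr /= ltnn !mul0r addr0.
congr (_ + _); first by apply: eq_bigr => j _; rewrite ltn_ord.
rewrite big_ord_recl /= !mul0r add0r; apply: eq_bigr => j _.
rewrite /lift /bump /= add1n.
have -> : j.+1%:Z - b%:Z = j%:Z - b%:Z + 1 by lia.
have jab := ltn_ord j; have := @theta_coefD1 a (j%:Z - b%:Z) ltac:(lia).
have -> : `|(a%:Z - (j%:Z - b%:Z))%R|%N = (a + b - j)%N by lia.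
move=> /(congr1 -%R); rewrite opprK => e.
by rewrite add0n [q ^+ _ * gauss _ _]mulrC -[in LHS](mulrA (gauss _ _)) -e; ring.
Qed.

Lemma fthetaSr a b c :
  ftheta a b.+1 c = ftheta a b c - q ^+ b.+1 * ftheta a b (fun r => c (r - 1)).
Proof.
rewrite /ftheta !addnS mulr_sumr -sumrN [RHS]addrC.
under eq_bigr => j _ do rewrite gauss_split' -1?ltnS // mulrDl mulrDl.
rewrite big_split /= big_ord_recr /= ltnn !mul0r addr0.
congr (_ + _); last first.
  rewrite big_ord_recl /= !mul0r add0r; apply: eq_bigr => j _.
  rewrite /lift /bump /= add1n.
  by have -> : j.+1%:Z - b.+1%:Z = j%:Z - b%:Z by lia.
apply: eq_bigr => j _; rewrite ltn_ord.
have -> : j%:Z - b.+1%:Z = j%:Z - b%:Z - 1 by lia.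
have jab := ltn_ord j; have := @theta_coefB1 b (j%:Z - b%:Z) ltac:(lia).
have -> : `|(b%:Z + (j%:Z - b%:Z))%R|%N = j by lia.
move=> /(congr1 -%R); rewrite opprK => e.
by rewrite [q ^+ _ * gauss _ _]mulrC -[in LHS](mulrA (gauss _ _)) -e; ring.
Qed.

(** * A Bailey pair *)

(** (x q; q)_n (q / x; q)_n at a primitive cube root of unity x. *)
Definition cyc3 (n : nat) : fps int :=
  \prod_(i < n) (1 + q ^+ i.+1 + q ^+ (2 * i.+1)).

Lemma ftheta00 c : ftheta 0 0 c = c 0.
Proof. by rewrite /ftheta big_ord1 /theta_coef /= subrr !mul1r. Qed.

(** Periodicity of [c] means x^3 = 1. The product contains 1 - x, and (1 - x) (1 + x + 1/x) = 0, so
    each pair (1 - x q^i) (1 - q^i / x) may be replaced by 1 + q^i + q^(2i). What remains is (1 - x)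
    (1 - q^(n+1) / x). *)
Lemma ftheta_periodic n (c : int -> fps int) : (forall r, c (r + 3) = c r) ->
  ftheta n.+1 n.+1 c =
  cyc3 n * ((1 + q ^+ n.+1) * c 0 - c 1 - q ^+ n.+1 * c (-1)).
Proof.
elim: n c => [|n IH] c c3.
  rewrite !(fthetaSl, fthetaSr) !ftheta00 /cyc3 big_ord0.
  by rewrite !addrK !add0r !expr0 !expr1; ring.
rewrite fthetaSr [ftheta n.+2 _ c]fthetaSl [ftheta n.+2 _ _]fthetaSl !IH //;
  try by move=> r; rewrite -[RHS]c3; congr c; lia.
rewrite /cyc3 big_ord_recr /=.
have -> : c (1 + 1) = c (-1) by rewrite -[RHS]c3.
have -> : c (-1 - 1) = c 1 by rewrite -[LHS]c3.
have -> : c (1 + 1 - 1) = c 1 by [].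
rewrite !addNr !add0r subrr mul2n -addnn exprD [q ^+ n.+2]exprS.
by ring.
Qed.

Lemma big_ord_center (R : nmodType) n (F : nat -> R) :
  \sum_(j < (n + n).+1) F j =
  F n + \sum_(1 <= r < n.+1) (F (n + r)%N + F (n - r)%N).
Proof.
rewrite -(big_mkord xpredT F) (@big_cat_nat _ _ _ n) /=; [|lia|lia].
rewrite [X in _ + X]big_ltn ?ltnS ?leq_addr // addrCA; congr (_ + _).
rewrite big_split /= addrC; congr (_ + _).
  rewrite -[n.+1 in LHS]add1n big_addn (_ : (n + n).+1 - n = n.+1)%N; last lia.
  by apply: eq_bigr => i _; rewrite addnC.
rewrite big_nat_rev big_add1 /=; apply: eq_big_nat => i _.
by congr F; lia.
Qed.

(** The sum of [theta_coef] at r and -r. *)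
Definition bailey_coef (r : nat) : fps int :=
  (-1) ^+ r * q ^+ 'C(r, 2) * (1 + q ^+ r).

Lemma ftheta_even n (c : int -> fps int) : (forall r, c (- r) = c r) ->
  ftheta n n c = gauss n n * c 0 +
    \sum_(1 <= r < n.+1) gauss (n - r) (n + r) * (bailey_coef r * c r%:Z).
Proof.
move=> ce; rewrite /ftheta (big_ord_center n (fun j : nat =>
  gauss (n + n - j) j * theta_coef (j%:Z - n%:Z) * c (j%:Z - n%:Z))).
rewrite subrr addnK {1}/theta_coef /= expr0 !mulr1; congr (_ + _).
apply: eq_big_nat => r /andP[r1 rn].
have -> : (n + r)%N%:Z - n%:Z = r by lia.
have -> : (n - r)%N%:Z - n%:Z = - r%:Z by lia.
have -> : (n + n - (n + r) = n - r)%N by lia.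
have -> : (n + n - (n - r) = n + r)%N by lia.
rewrite (gaussC (n + r)) ce /theta_coef /bailey_coef abszN absz_nat.
have -> : triz (- r%:Z) = ('C(r, 2) + r)%N.
  by have := trizN r; rewrite [triz r%:Z]/=; lia.
by rewrite exprD /=; ring.
Qed.

(** Here r = s + 1 and n = r + k. With X = q^r and Y = q^(K+1), the closed form grows by the next
    term because (1 - X Y)^2 - (1 - Y) (1 - X^2 Y) = Y (1 - X)^2. *)
Lemma bailey_tele s K :
  \sum_(k < K.+1) q ^+ (s.+1 + k) * qf (s + k) ^+ 2 / (qf k * qf (s.+1 + k + s.+1))
  = q ^+ s.+1 / (1 - q ^+ s.+1) ^+ 2
    * (qf (s.+1 + K) ^+ 2 / (qf K * qf (s.+1 + K + s.+1))).
Proof.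
have U := unit_1X (ltn0Sn s); have QU := qf_unit.
have DU : (1 - q ^+ s.+1) ^+ 2 \is a GRing.unit by rewrite unitrX.
elim: K => [|K IH].
  rewrite big_ord1 !addn0 qf0 !mul1r [qf s.+1]qfS exprMn.
  move: DU; set D := (1 - _) ^+ 2 => DU.
  rewrite (_ : q ^+ s.+1 / D * _ = q ^+ s.+1 * qf s ^+ 2 / qf (s.+1 + s.+1) * (D / D)); last by ring.
  by rewrite divrr // mulr1.
rewrite big_ord_recr /= {}IH; set x := s.+1.
set a := (qf K.+1 * qf (x + K.+1 + x))^-1.
have -> : (qf K * qf (x + K + x))^-1 =
    (1 - q ^+ K.+1) * (1 - q ^+ (x + K + x).+1) * a.
  rewrite /a addnS addSn [qf K.+1]qfS [qf (_ + x).+1]qfS.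
  set y := 1 - q ^+ K.+1; set z := 1 - q ^+ (x + K + x).+1.
  have yU : y \is a GRing.unit by exact: unit_1X.
  have zU : z \is a GRing.unit by exact: unit_1X.
  apply: (mulIr (_ : qf K * qf (x + K + x) \is a GRing.unit));
    first by rewrite unitrM !QU.
  rewrite mulVr ?unitrM ?QU //; apply/esym.
  rewrite -[RHS](@divrr _ (qf K * y * (qf (x + K + x) * z))); first by ring.
  by rewrite !unitrM !QU yU zU.
have -> : (s + K.+1 = x + K)%N by rewrite /x; lia.
have -> : q ^+ (x + K.+1) =
    q ^+ x / (1 - q ^+ x) ^+ 2 * (q ^+ K.+1 * (1 - q ^+ x) ^+ 2).
  by rewrite [q ^+ K.+1 * _]mulrC mulrA divrK // exprD.
set D := q ^+ x / _; clearbody a D.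
have -> : qf (x + K.+1) = qf (x + K) * (1 - q ^+ x * q ^+ K.+1).
  by rewrite addnS [LHS]qfS -addnS exprD.
have -> : q ^+ (x + K + x).+1 = q ^+ x * q ^+ x * q ^+ K.+1.
  by rewrite -!exprD; congr (_ ^+ _); lia.
by ring.
Qed.


(** The correction factor of the sum truncated at N; it tends to 1, see [upoch_eqX]. *)
Definition upoch (N r : nat) : fps int := qf N ^+ 2 / (qf (N - r) * qf (N + r)).

Lemma bailey_tele_nat r N : (0 < r)%N -> (r <= N)%N ->
  \sum_(r <= n < N.+1) q ^+ n * qf n.-1 ^+ 2 / (qf (n - r) * qf (n + r))
  = q ^+ r / (1 - q ^+ r) ^+ 2 * upoch N r.
Proof.
case: r => // s _ rN; have := bailey_tele s (N - s.+1).
rewrite /upoch subnKC // => <-.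
rewrite -{1}[s.+1]add0n big_addn big_mkord subSn //.
apply: eq_bigr => k _; rewrite addnK.
by have -> : (k + s.+1 = s.+1 + k)%N by lia.
Qed.

(* The specialization at [x = exp (2 i pi / 3)] of the Bailey pair with
   [beta_n = (1 + q^n) (x; q)_n (1 / x; q)_n / (q; q)_(2 n)], up to the
   factor 3 and the trivial pair. *)
Lemma bailey_pair_cyc3 n : (0 < n)%N ->
  (1 + q ^+ n) * cyc3 n.-1 / qf (n + n) =
  (qf n ^+ 2)^-1 + \sum_(1 <= r < n.+1 | (3 %| r)%N)
     bailey_coef r / (qf (n - r) * qf (n + r)).
Proof.
(* The indicator of 3 | r is the average of x^r over the three cube roots of unity; x = 1
   contributes nothing to the product. *)
case: n => // n _; pose c (r : int) : fps int := (3 %| r)%Z%:R.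
have c3 r : c (r + 3) = c r by rewrite /c; congr (_%:R : fps int); lia.
have ce r : c (- r) = c r by rewrite /c; congr (_%:R : fps int); lia.
have := ftheta_periodic n c3; rewrite ftheta_even //.
rewrite (_ : c 0 = 1) // (_ : c 1 = 0) // (_ : c (-1) = 0) //.
rewrite !mulr0 !subr0 !mulr1 [cyc3 n * _]mulrC => <-.
rewrite mulrDl gauss_divE expr2; congr (_ + _).
rewrite mulr_suml [RHS]big_mkcond; apply: eq_big_nat => r /andP[r1 rn].
have e : (n.+1 + n.+1 = (n.+1 - r) + (n.+1 + r))%N by lia.
rewrite mulrAC {}e gauss_divE mulrC {1}/c.
have -> : (3 %| r%:Z)%Z = (3 %| r)%N by [].
by case: ifP => _; rewrite ?mulr1 ?mulr0 ?mul0r.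
Qed.

(** The first term of [bailey_pair_cyc3] gives q^n / (1 - q^n)^2 at once. In the remaining double
    sum the order is exchanged, and the sum over n is [bailey_tele_nat]. *)
Lemma bailey_sum N :
  \sum_(1 <= n < N.+1)
     q ^+ n * qf n.-1 ^+ 2 * ((1 + q ^+ n) * cyc3 n.-1 / qf (n + n)) =
  \sum_(1 <= n < N.+1) q ^+ n / (1 - q ^+ n) ^+ 2 +
  \sum_(1 <= r < N.+1 | (3 %| r)%N)
     bailey_coef r * (q ^+ r / (1 - q ^+ r) ^+ 2 * upoch N r).
Proof.
transitivity (\sum_(1 <= n < N.+1) (q ^+ n / (1 - q ^+ n) ^+ 2 +
  \sum_(1 <= r < N.+1 | (3 %| r)%N && (r <= n)%N)
     bailey_coef r * (q ^+ n * qf n.-1 ^+ 2 / (qf (n - r) * qf (n + r))))).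
  apply: eq_big_nat => n /andP[n1 nN]; rewrite bailey_pair_cyc3 // mulrDr.
  congr (_ + _).
    case: n n1 {nN} => // n _; rewrite /= qfS exprMn invrM ?unitrX ?qf_unit //;
      last exact: unit_1X.
    by rewrite mulrACA divrr ?mulr1 // unitrX // qf_unit.
  rewrite mulr_sumr (big_nat_widen _ _ N.+1) //.
  by apply: eq_bigr => r _; ring.
rewrite big_split /=; congr (_ + _).
rewrite (exchange_big_dep_nat (fun r => (3 %| r)%N)) /=;
  last by move=> ? ? _ _ _ /andP[].
rewrite big_nat_cond [RHS]big_nat_cond; apply: eq_bigr => r /andP[/andP[r1 rN] r3].
rewrite -mulr_sumr -bailey_tele_nat //; congr (_ * _).
rewrite [RHS](big_nat_widenl _ 1) //; apply: eq_bigl => n.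
by rewrite r3.
Qed.

(** * The generating function of spt_{2,3} *)

Lemma sum_dvd3 (R : nmodType) (F : nat -> R) M :
  \sum_(i < (3 * M).+1 | (3 %| i)%N) F i = \sum_(j < M.+1) F (3 * j)%N.
Proof.
elim: M => [|M IH]; first by rewrite big_mkcond !big_ord1.
rewrite big_ord_recr /= -IH (_ : (3 * M.+1).+1 = (3 * M).+4)%N; last lia.
rewrite [LHS]big_mkcond 3!big_ord_recr -big_mkcond /=.
have -> : (3 %| (3 * M).+1)%N = false by lia.
have -> : (3 %| (3 * M).+2)%N = false by lia.
have -> : (3 %| (3 * M).+3)%N by lia.
by rewrite !addr0 mulnS addnC !addnS addn0.
Qed.

(** The substitution of q^3 for q. *)
Definition dil3 (f : fps int) : fps int :=
  Fps (fun n => if (3 %| n)%N then fcoef f (n %/ 3) else 0).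

Lemma fcoef_dil3 f n :
  fcoef (dil3 f) n = if (3 %| n)%N then fcoef f (n %/ 3) else 0.
Proof. by []. Qed.

Fact dil3_additive : zmod_morphism dil3.
Proof.
by move=> f g; apply: fpsP => n; rewrite !(fcoefD, fcoefN, fcoef_dil3); case: ifP.
Qed.

Fact dil3_multiplicative : monoid_morphism dil3.
Proof.
split=> [|f g]; apply: fpsP => n.
  by case: n => [|n] //=; case: ifP => // n3; rewrite (_ : _ == _ = false) //; lia.
rewrite fcoefM fcoef_dil3; under [RHS]eq_bigr do rewrite !fcoef_dil3.
case: ifP => [/dvdnP[m ->]|n3].
  rewrite mulnK // fcoefM mulnC (eq_bigr (fun i : 'I_(3 * m).+1 => if (3 %| i)%N
     then fcoef f (i %/ 3) * fcoef g (m - i %/ 3)%N else 0)); last first.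
    move=> i _; case: ifP => [i3|]; last by rewrite mul0r.
    have im := ltn_ord i; have -> : (3 %| 3 * m - i)%N by lia.
    by congr (_ * fcoef g _); lia.
  rewrite -big_mkcond (sum_dvd3 (fun i => fcoef f (i %/ 3) * fcoef g (m - i %/ 3)%N)).
  by apply: eq_bigr => j _; rewrite mulKn.
rewrite big1 // => i _; case: ifP => [i3|]; last by rewrite mul0r.
have im := ltn_ord i; have -> : (3 %| n - i)%N = false by lia.
by rewrite mulr0.
Qed.

HB.instance Definition _ := GRing.isZmodMorphism.Build _ _ dil3 dil3_additive.
HB.instance Definition _ := GRing.isMonoidMorphism.Build _ _ dil3 dil3_multiplicative.

Lemma dil3X n : dil3 (q ^+ n) = q ^+ (3 * n).
Proof.
apply: fpsP => k; rewrite fcoef_dil3 !fcoef_Xn; case: ifP => [/dvdnP[m ->]|k3].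
  by rewrite mulnK // mulnC eqn_pmul2l.
by rewrite (_ : _ == _ = false) //; apply/eqP; lia.
Qed.

Lemma dil3_eqX N f g : eqX N f g -> eqX N (dil3 f) (dil3 g).
Proof.
by move=> fg k kN; rewrite !fcoef_dil3; case: ifP => // _; apply: fg; lia.
Qed.

Lemma qf_cyc3 n : dil3 (qf n) = qf n * cyc3 n.
Proof.
rewrite /qf /cyc3 rmorph_prod -big_split /=; apply: eq_bigr => i _.
by rewrite rmorphB rmorph1 /= dil3X mulnC [(2 * _)%N]mulnC !exprM /=; ring.
Qed.

Definition qinf3 : fps int := qpoch_inf (q ^+ 3) (q ^+ 3).

Lemma qpoch3 n : qpoch (q ^+ 3) (q ^+ 3) n = dil3 (qf n).
Proof.
rewrite /qpoch /qf big_mkord rmorph_prod; apply: eq_bigr => i _.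
by rewrite rmorphB rmorph1 /= dil3X -exprS exprM.
Qed.

Lemma qinf3_eqX N n : (N < n)%N -> eqX N qinf3 (dil3 (qf n)).
Proof.
move=> Nn k kN; rewrite -qpoch3; apply: fcoef_qpoch_inf;
  last exact: leq_ltn_trans Nn.
by rewrite fcoef_Xn.
Qed.

Lemma qinf3_unit : qinf3 \is a GRing.unit.
Proof.
suff: fcoef qinf3 0 \is a GRing.unit by [].
by rewrite (@qinf3_eqX 0 1) // /dil3 /= qfS qf0 mul1r fcoefD fcoefN fcoef_Xn fcoef1.
Qed.

Lemma qinf3_split n : qinf3 = dil3 (qf n) * qpoch_inf (q ^+ (3 * n.+1)) (q ^+ 3).
Proof.
apply: fpsP => k; rewrite (@qinf3_eqX k (n + k.+1)) //; last by lia.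
have q0 : fcoef (q ^+ 3) 0 = 0 by rewrite fcoef_Xn.
rewrite (@eqXM k _ (dil3 (qf n)) _ (qpoch (q ^+ (3 * n.+1)) (q ^+ 3) k.+1)) //;
  last first.
  by move=> j jk; apply: fcoef_qpoch_inf => //; rewrite ltnS.
congr fcoef; rewrite /qf big_split_ord rmorphM /=; congr (_ * _).
rewrite /qpoch big_mkord rmorph_prod; apply: eq_bigr => i _.
by rewrite rmorphB rmorph1 /= dil3X -exprM -exprD; congr (1 - _ ^+ _); lia.
Qed.

(** The tail of (q^3; q^3)_oo cancels the infinite product in the denominator and leaves (q^3;
    q^3)_(n-1) = (q)_(n-1) [cyc3 n.-1]. The other factors, times (q)_(n-1) (1 + q^n), make up
    (q)_2n. *)
Lemma spt23_den_qf n : (0 < n)%N ->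
  qinf3 * (q ^+ n / spt23_den n) =
  q ^+ n * qf n.-1 ^+ 2 * ((1 + q ^+ n) * cyc3 n.-1 / qf (n + n)).
Proof.
case: n => // n _; rewrite (qinf3_split n) qf_cyc3 /=.
have nU : 1 - q ^+ n.+1 \is a GRing.unit by exact: unit_1X.
have denU := spt23_den_unit (ltn0Sn n).
apply: (mulIr denU); apply: (mulIr (qf_unit (n.+1 + n.+1))).
set A := qpoch_inf _ _; set d := spt23_den n.+1; set P := qf (n.+1 + n.+1).
transitivity (qf n * cyc3 n * A * (q ^+ n.+1 / d * d) * P); first by ring.
rewrite divrK // [RHS](_ : _ = q ^+ n.+1 * qf n ^+ 2 * d *
  ((1 + q ^+ n.+1) * cyc3 n / P * P)); last by ring.
rewrite divrK ?qf_unit // /d /P /spt23_den -/A.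
have -> : qf (n.+1 + n.+1) = qf n * (\prod_(n.+1 <= i < 2 * n.+1) (1 - q ^+ i))
    * (1 - q ^+ n.+1) * (1 + q ^+ n.+1).
  rewrite addnS qfS -mulrA; congr (_ * _); last first.
    by rewrite -addnS exprD; ring.
  rewrite -[X in \prod_(X <= _ < _) _]add0n big_addn (_ : 2 * n.+1 - n.+1 = n.+1)%N; last lia.
  rewrite big_mkord addSn -addnS /qf big_split_ord /=; congr (_ * _).
  by apply: eq_bigr => i _; congr (1 - _ ^+ _); lia.
by ring.
Qed.

(** m (3 m + 1) / 2. *)
Definition rank_exp (m : nat) : nat := ('C(m, 2) + m * m + m)%N.

Definition rank_term (m : nat) : fps int :=
  (-1) ^+ m * q ^+ rank_exp m * (1 + q ^+ m) / (1 - q ^+ m) ^+ 2.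

Lemma bin2_3 m : ('C(3 * m, 2) + 3 * m = 3 * rank_exp m)%N.
Proof.
rewrite /rank_exp; elim: m => [//|m IH].
have -> : (3 * m.+1 = (3 * m).+3)%N by lia.
by rewrite !binS !bin1 !bin0; nia.
Qed.

Lemma dil3_rank_term m : (0 < m)%N ->
  bailey_coef (3 * m) * (q ^+ (3 * m) / (1 - q ^+ (3 * m)) ^+ 2) =
  dil3 (rank_term m).
Proof.
move=> m0; rewrite /rank_term rmorphM rmorphV ?unitrX ?unit_1X // !rmorphM.
rewrite !rmorphXn rmorphN rmorphD rmorphB rmorph1 /= !dil3X mulrA; congr (_ * _).
have -> : (-1) ^+ m = (-1) ^+ (3 * m) :> fps int.
  by rewrite -signr_odd -[RHS]signr_odd oddM.
have X1 : dil3 q = q ^+ 3 by exact: (dil3X 1).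
by rewrite X1 -exprM /bailey_coef -bin2_3 exprD; ring.
Qed.

(** All three of (q)_N, (q)_(N-r), (q)_(N+r) agree to order N - r. The r orders missing up to N come
    from a factor q^r where this is applied. *)
Lemma upoch_eqX N r : (r <= N)%N -> eqX (N - r) (upoch N r) 1.
Proof.
move=> rN;
  have U : qf (N - r) * qf (N + r) \is a GRing.unit by rewrite unitrM !qf_unit.
apply: (eqX_mulI U); rewrite mulrC divrK // mulr1 expr2.
apply: (@eqX_trans _ _ (qf (N - r) * qf (N - r))).
  by apply: eqXM; apply: eqX_qf => //; lia.
by apply: eqXM => //; apply: eqX_sym; apply: eqX_qf => //; lia.
Qed.

Lemma spt23_eqX N :
  eqX N (qinf3 * spt23_gf) (\sum_(1 <= n < N.+1) q ^+ n / (1 - q ^+ n) ^+ 2 +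
                            dil3 (\sum_(1 <= m < N.+1) rank_term m)).
Proof.
apply: (@eqX_trans _ _ (\sum_(1 <= n < N.+1) qinf3 * (q ^+ n / spt23_den n))).
  rewrite -mulr_sumr; apply: eqXM => // k kN.
  by apply: fcoef_fps_sum => //; exact: fcoef_spt23_term.
rewrite (eq_big_nat _ _ (fun n H => spt23_den_qf (proj1 (andP H)))).
rewrite bailey_sum; apply: eqXD => //.
rewrite rmorph_sum.
(* Vanishing outside 1 <= r <= N, [F] allows passing between the multiples of 3 up to N and those up
   to 3 N. *)
pose F r := if (0 < r <= N)%N then bailey_coef r * (q ^+ r / (1 - q ^+ r) ^+ 2) else 0.
apply: (@eqX_trans _ _ (\sum_(i < (3 * N).+1 | (3 %| i)%N) F i)).
  rewrite -(big_mkord (fun i => 3 %| i)%N) [X in eqX _ _ X]big_mkcond.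
  rewrite [X in eqX _ _ X](@big_cat_nat _ _ _ N.+1) /=; [|lia|lia].
  rewrite [X in eqX _ _ (_ + X)](_ : _ = 0) ?addr0; last first.
    rewrite big_nat_cond big1 // => i /andP[/andP[Ni _] _].
    by rewrite /F (leqNgt i) Ni andbF if_same.
  rewrite [X in eqX _ _ X]big_ltn // {1}/F ltnn /= add0r big_mkcond /=.
  rewrite big_nat_cond [X in eqX _ _ X]big_nat_cond.
  apply: eqX_sum => r _ /andP[/andP[r1 rN] _]; case: ifP => // _.
  rewrite /F r1 -ltnS rN /=.
  have e z : bailey_coef r * (q ^+ r / (1 - q ^+ r) ^+ 2 * z) =
     q ^+ r * (bailey_coef r / (1 - q ^+ r) ^+ 2 * z) by ring.
  rewrite -[X in eqX _ _ (_ * X)]mulr1 !e.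
  (* The factor q^r restores the r orders lost in [upoch_eqX]. *)
  apply: (@eqX_XnM _ (N - r)); first by lia.
  by apply: eqXM => //; apply: upoch_eqX.
rewrite sum_dvd3 -(big_mkord xpredT (fun j => F (3 * j)%N)) big_ltn //.
rewrite {1}/F muln0 /= add0r big_nat_cond [X in eqX _ _ X]big_nat_cond.
apply: eqX_sum => m _ /andP[/andP[m1 mN] _]; rewrite -dil3_rank_term // /F.
(* For 3 m > N the summand of [F] is 0, and the target is divisible by q^(3 m). *)
rewrite muln_gt0 m1 /=; case: leqP => // Nm; apply: eqX_sym.
by rewrite mulrCA; apply: eqX_XnM0.
Qed.

(** * Partitions in a box *)

Definition partitions (n : nat) : {fset seq nat} :=
  fset_set [set s | is_partition n s]%classic.

Lemma in_partitions n s : (s \in partitions n) = is_partition n s.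
Proof.
rewrite in_fset_set; last exact: finite_partitions.
by apply/idP/idP; rewrite inE.
Qed.

Definition maxpart (s : seq nat) : nat := (\max_(i <- s) i)%N.

Lemma maxpart_leP s a : (maxpart s <= a)%N = all (geq a) s.
Proof.
apply/idP/allP => [/bigmax_leqP_seq h x xs|h]; first exact: h.
by apply/bigmax_leqP_seq => x xs _; exact: h.
Qed.

Lemma is_partition_cons n x t : is_partition n (x :: t) =
  [&& (0 < x)%N, (x <= n)%N, is_partition (n - x) t & (maxpart t <= x)%N].
Proof.
rewrite maxpart_leP /is_partition /= path_sortedE; last first.
  by move=> a b c /= ab bc; apply: leq_trans bc ab.
by case: (sorted _ _); case: (all _ t); case: (all _ t) => //=; lia.
Qed.

Lemma maxpart_cons x t : (maxpart t <= x)%N -> maxpart (x :: t) = x.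
Proof. by rewrite /maxpart big_cons => /maxn_idPl. Qed.

Lemma partition_bounds n s : is_partition n s ->
  (maxpart s <= n)%N /\ (size s <= n)%N.
Proof.
elim: s n => [|x t IH] n; first by rewrite /maxpart big_nil.
rewrite is_partition_cons => /and4P[x0 xn /IH[_ h2] h]; rewrite maxpart_cons //=.
by split; lia.
Qed.

Lemma partition_nil n s : is_partition n s -> (maxpart s == 0%N) = (s == [::]).
Proof.
case: s => [|x t]; first by rewrite /maxpart big_nil.
rewrite is_partition_cons => /and4P[x0 _ _ h]; rewrite maxpart_cons //.
by case: x x0 {h}.
Qed.

Lemma sum_partitions_nil n :
  \sum_(s <- partitions n | s == [::]) 1 = (n == 0%N)%:R :> int.
Proof.
rewrite -big_filter; have [->|n0] := eqVneq n 0%N.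
  rewrite (perm_big [:: [::]]) ?big_seq1 //=; apply: uniq_perm => //.
    by rewrite filter_uniq ?fset_uniq.
  move=> s; rewrite mem_filter in_partitions inE.
  by case: eqP => [->|].
rewrite big_seq big1 // => s; rewrite mem_filter in_partitions.
by move=> /andP[/eqP ->]; rewrite /is_partition /= eq_sym (negPf n0).
Qed.

Lemma sum_partitions_max n a (F : seq nat -> int) : (0 < a <= n)%N ->
  \sum_(s <- partitions n | maxpart s == a) F s =
  \sum_(t <- partitions (n - a) | (maxpart t <= a)%N) F (a :: t).
Proof.
move=> /andP[a0 an]; rewrite -big_filter -[RHS]big_filter.
rewrite -[RHS](big_map (cons a) xpredT F); apply: perm_big; apply: uniq_perm.
- by rewrite filter_uniq ?fset_uniq.
- by rewrite map_inj_uniq ?filter_uniq ?fset_uniq // => ? ? [].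
move=> s; rewrite mem_filter in_partitions.
apply/andP/mapP => [[/eqP sa sn]|[t]].
  case: s sa sn => [|x t]; first by rewrite /maxpart big_nil; lia.
  move=> sa; rewrite is_partition_cons => /and4P[x0 xn tn tx].
  move: sa; rewrite maxpart_cons // => <-.
  by exists t => //; rewrite mem_filter in_partitions tx.
rewrite mem_filter in_partitions => /andP[ta tn] ->.
by rewrite maxpart_cons // is_partition_cons eqxx a0 an tn ta.
Qed.

Lemma sum_partitions_nilE n (P : pred (seq nat)) :
  (forall s, is_partition n s -> P s = (s == [::])) ->
  \sum_(s <- partitions n | P s) 1 = fcoef (1 : fps int) n.
Proof.
move=> PE; rewrite fcoef1 -sum_partitions_nil big_seq_cond [RHS]big_seq_cond.
by apply: eq_bigl => s; case: (boolP (s \in _)) => //=;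
  rewrite in_partitions => /PE.
Qed.

(** The q-Pascal rule splits by the largest part: either it is at most a, or it equals a + 1 and is
    removed. *)
Lemma partitions_box a b n :
  \sum_(s <- partitions n | (maxpart s <= a)%N && (size s <= b)%N) 1 =
  fcoef (gauss a b) n.
Proof.
elim: a b n => [|a IHa] b n.
  rewrite gauss0n sum_partitions_nilE // => s sn.
  rewrite leqn0 (partition_nil sn) /=.
  by case: eqP => // ->.
elim: b n => [|b IHb] n.
  rewrite gaussn0 sum_partitions_nilE // => s _; rewrite leqn0 size_eq0.
  by case: eqP => [->|]; rewrite ?andbF // /maxpart big_nil.
rewrite gaussSS fcoefD fcoef_XnM -IHa.
rewrite (bigID (fun s => (maxpart s <= a)%N)) /=; congr (_ + _).
  by apply: eq_bigl => s; move: (maxpart s) (size s); lia.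
transitivity (\sum_(s <- partitions n | maxpart s == a.+1)
    if (size s <= b.+1)%N then 1 else 0 : int).
  by rewrite -big_mkcondr; apply: eq_bigl => s;
    rewrite -ltnNge eqn_leq ![(maxpart _ <= _)%N && _]andbC -andbA;
    move: (maxpart s) (size s); lia.
have [an|an] := leqP a.+1 n; last first.
  rewrite big_seq_cond big1 // => s /andP[]; rewrite in_partitions.
  by move=> /partition_bounds[h _] /eqP; lia.
rewrite sum_partitions_max // -IHb.
by rewrite -big_mkcondr.
Qed.

(** * Dyson's rank recurrence and the second rank moment *)

Arguments fcoef : simpl never.

Lemma sum_by_value (T : eqType) (f : T -> nat) n (r : seq T) (P : pred T)
    (F : T -> int) : (forall s, s \in r -> f s <= n)%N ->
  \sum_(s <- r | P s) F s =
  \sum_(a < n.+1) \sum_(s <- r | P s && (f s == a)) F s.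
Proof.
move=> fn; rewrite (exchange_big_dep P) /=; last by move=> ? ? _ /andP[].
rewrite big_seq_cond [RHS]big_seq_cond; apply: eq_bigr => s /andP[/fn sn Ps].
rewrite (big_pred1 (inord (f s))) // => a; rewrite Ps /=.
by rewrite -val_eqE /= inordK // eq_sym.
Qed.

Definition rank_ge (m n : nat) : int :=
  \sum_(s <- partitions n | (size s + m <= maxpart s)%N) 1.
Definition npart (n : nat) : int := \sum_(s <- partitions n) 1.

(** The mirror q-Pascal rule removes the partitions with at most c parts; the factor q^(c+1) takes 1
    from each of the c + 1 parts. *)
Lemma partitions_size d c n :
  \sum_(s <- partitions n | (maxpart s <= d.+1)%N && (size s == c.+1)) 1 =
  fcoef (q ^+ c.+1 * gauss d c.+1) n.
Proof.
have := congr1 (fun f => fcoef f n) (gaussSS' d c).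
rewrite fcoefD -!partitions_box => e; apply: (addrI (\sum_(s <- partitions n |
   (maxpart s <= d.+1)%N && (size s <= c)%N) 1)); rewrite -{}e.
rewrite [RHS](bigID (fun s : seq nat => size s <= c)%N) /=; congr (_ + _);
  apply: eq_bigl => s; move: (maxpart s) (size s) => x y.
  by case: (x <= _)%N => //=; lia.
by case: (x <= _)%N => //=; lia.
Qed.

(** Sorting by the largest part a: once it is removed, at most a - m - 2 parts of size at most a
    remain. *)
Lemma rank_ge_sum m n : rank_ge m.+1 n = \sum_(a < n.+1)
  if (m.+1 < a)%N then fcoef (q ^+ a * gauss a (a - m.+2)) n else 0.
Proof.
rewrite /rank_ge (@sum_by_value _ maxpart n); last first.
  by move=> s; rewrite in_partitions => /partition_bounds[].
apply: eq_bigr => -[a /= an] _.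
transitivity (\sum_(s <- partitions n | maxpart s == a)
    if (size s + m.+1 <= a)%N then 1 else 0 : int).
  rewrite -big_mkcondr; apply: eq_bigl => s.
  by rewrite andbC; case: eqP => //= ->.
case: a an => [|a] an.
  by apply: big1 => s _; rewrite addnS.
rewrite sum_partitions_max // fcoef_XnM -[(a < n)%N]ltnS an.
case: leqP => ma.
  by apply: big1 => s _; rewrite leqNgt (_ : (_ < _)%N) //=; lia.
rewrite -partitions_box -big_mkcondr; apply: eq_bigl => s /=.
by congr (_ && _); lia.
Qed.

(** Conjugation negates the rank. It is realized by sorting by the number of parts and using
    [gaussC]. *)
Lemma rank_le_conj m n :
  \sum_(s <- partitions n | (maxpart s + m.+1 <= size s)%N) 1 = rank_ge m.+1 n.
Proof.
rewrite rank_ge_sum (@sum_by_value _ size n); last first.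
  by move=> s; rewrite in_partitions => /partition_bounds[].
apply: eq_bigr => -[a /= an] _; case: leqP => ma.
  rewrite big_seq_cond big1 // => s; rewrite in_partitions.
  move=> /and3P[/partition_nil sn sm /eqP sa].
  have : maxpart s == 0%N by move: sm; rewrite sa; lia.
  rewrite sn => /eqP s0; move: sm sa; rewrite s0 /maxpart big_nil /=; lia.
case: a an ma => // a an; rewrite ltnS => ma.
have -> : (a.+1 - m.+2 = a - m.+1)%N by lia.
rewrite gaussC -partitions_size; apply: eq_bigl => s.
by case: eqP => [->|]; rewrite ?andbF // !andbT; lia.
Qed.

Lemma rank_lt_sum k n :
  \sum_(s <- partitions n | (maxpart s <= size s + k.+1)%N) 1 =
  \sum_(c < n.+1) fcoef (q ^+ c * gauss (c + k) c) n.
Proof.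
rewrite (@sum_by_value _ size n); last first.
  by move=> s; rewrite in_partitions => /partition_bounds[].
apply: eq_bigr => -[a /= an] _; case: a an => [|a] an.
  rewrite mul1r gaussn0 sum_partitions_nilE // => s _.
  by case: s => [|x s]; rewrite ?andbF // /maxpart big_nil.
rewrite addSn -partitions_size; apply: eq_bigl => s.
by case: eqP => [->|]; rewrite ?andbF // !andbT addSn addnS.
Qed.

(* Dyson's adjoint: delete a largest part [a], then add 1 to each of [a - m - 2]
   parts, the empty ones included. *)
Lemma rank_ge_rec m n : rank_ge m.+1 n =
  if (m.+1 < n)%N then npart (n - m.+2) - rank_ge (m.+1 + 3) (n - m.+2) else 0.
Proof.
rewrite rank_ge_sum; case: ltnP => mn; last first.
  by apply: big1 => -[a /= an] _; case: ltnP => //; lia.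
have -> : npart (n - m.+2) - rank_ge (m.+1 + 3) (n - m.+2) =
    \sum_(s <- partitions (n - m.+2) | (maxpart s <= size s + m.+3)%N) 1.
  apply/eqP; rewrite subr_eq /npart; apply/eqP.
  rewrite (bigID (fun s => (maxpart s <= size s + m.+3)%N)) /=; congr (_ + _).
  by apply: eq_bigl => s; rewrite -ltnNge; move: (size s) (maxpart s); lia.
rewrite rank_lt_sum.
rewrite -(big_mkord xpredT (fun a => if (m.+1 < a)%N then
   fcoef (q ^+ a * gauss a (a - m.+2)) n else 0)).
rewrite (@big_cat_nat _ _ _ m.+2) /=; [|lia|lia].
rewrite big_nat_cond big1 ?add0r; last first.
  by move=> a /andP[/andP[_ am] _]; rewrite leqNgt am.
(* Largest part a = c + m + 2 on the left matches c parts on the right: both give the Gaussian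
   binomial of c + m + 2 and c. *)
rewrite -{1}[m.+2]add0n big_addn subSn // big_mkord; apply: eq_bigr => -[c /= cn] _.
rewrite addnK !fcoef_XnM.
have -> : (c <= n - m.+2)%N by rewrite -ltnS.
have -> : (m.+1 < c + m.+2)%N by lia.
have -> : (c + m.+2 <= n)%N by lia.
by congr (fcoef (gauss _ _) _); lia.
Qed.

Lemma Nrank_sum m n :
  (Nrank m n)%:Z = \sum_(s <- partitions n | partition_rank s == m) 1.
Proof.
rewrite /Nrank; set A := fset_set _.
rewrite -big_filter (perm_big (enum_fset A)) /=; last first.
  apply: uniq_perm => [||s].
  - by rewrite filter_uniq ?fset_uniq.
  - exact: fset_uniq.
  rewrite mem_filter in_partitions in_fset_set; last first.
    by apply: sub_finite_set (finite_partitions n) => t [].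
  apply/andP/idP => [[/eqP sm sn]|]; rewrite inE /=; first by split.
  by case=> -> ->.
by rewrite big_const_seq count_predT iter_addr_0 natz.
Qed.

Lemma N2_sum n : N2 n = \sum_(s <- partitions n) partition_rank s ^+ 2.
Proof.
pose A := [fset partition_rank s | s in partitions n]%fset.
rewrite /N2 (@fsbigTE _ _ _ _ A); last first.
  move=> m mA; rewrite Nrank_sum big_seq_cond big1 ?mulr0 // => s /andP[sn /eqP sm].
  by case/negP: mA; apply/imfsetP; exists s.
under eq_bigr => m _ do rewrite Nrank_sum mulr_sumr.
rewrite (exchange_big_dep xpredT) //= big_seq [RHS]big_seq.
apply: eq_bigr => s sn; rewrite (big_rem (partition_rank s)) /=; last first.
  by apply/imfsetP; exists s.
rewrite eqxx mulr1 big_seq_cond big1 ?addr0 // => m /andP[].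
rewrite mem_rem_uniq ?fset_uniq // inE => /andP[/negPf mr _] /eqP rm.
by rewrite rm eqxx in mr.
Qed.

(** The sum of the squares of the positive ranks, by parts: a partition of rank k > 0 is counted
    with weight 1 + 3 + ... + (2 k - 1) = k^2. *)
Definition half_N2 (n : nat) : int :=
  \sum_(m < n) (2 * m + 1)%N%:Z * rank_ge m.+1 n.

Lemma sum_odd k : \sum_(m < k) (2 * m + 1)%N%:Z = k%:Z ^+ 2.
Proof. by elim: k => [|k IH]; rewrite ?big_ord0 // big_ord_recr /= IH; lia. Qed.

(** By [rank_le_conj], the negative ranks contribute as much as the positive ones. *)
Lemma N2E n : N2 n = 2 * half_N2 n.
Proof.
rewrite N2_sum mulr_natl mulr2n {1}/half_N2.
rewrite -(eq_bigr _ (fun (m : 'I_n) _ => congr1 ( *%R _) (rank_le_conj m n))).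
rewrite /half_N2 -big_split /=.
under [RHS]eq_bigr => m _ do rewrite !mulr_sumr !(big_mkcond (fun s => leq _ _)) -big_split /=.
rewrite exchange_big /= big_seq [RHS]big_seq; apply: eq_bigr => s.
rewrite in_partitions => /partition_bounds[sm ss].
rewrite big_split /= /partition_rank -/(maxpart s).
(* Subtraction is truncated, so of the two squares obtained at most one is nonzero. *)
have sumE a b : (a <= n)%N -> \sum_(i < n) (if (b + i.+1 <= a)%N then (2 * i + 1)%N%:Z * 1 else 0) = (a - b)%N%:Z ^+ 2.
  move=> an;
    rewrite -big_mkcond -sum_odd (big_ord_widen n (fun i => (2 * i + 1)%N%:Z));
    last by lia.
  by apply: eq_big => [i|i _]; [lia|rewrite mulr1].
rewrite !sumE //; have [h|/ltnW h] := leqP (maxpart s) (size s).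
  have -> : (maxpart s - size s = 0)%N by lia.
  by rewrite -subzn // expr0n /=; ring.
have -> : (size s - maxpart s = 0)%N by lia.
by rewrite -subzn // expr0n /=; ring.
Qed.

(** * The generating function of the second rank moment *)

Definition npart_gf : fps int := Fps npart.

(** Every partition of k <= N fits into an N by N box, and (q)_N^2 [gauss N N] = (q)_2N, which
    agrees with (q)_N to order N. *)
Lemma npart_eqX N : eqX N (qf N * npart_gf) 1.
Proof.
apply: (eqX_mulI (qf_unit N)); rewrite mulr1.
apply: (@eqX_trans _ _ (qf N * (qf N * gauss N N))).
  apply: eqXM => //; apply: eqXM => //.
  move=> k kN; rewrite -partitions_box /fcoef /= /npart big_seq [RHS]big_seq_cond.
  apply: eq_bigl => s; case: (boolP (s \in _)) => //=; rewrite in_partitions.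
  by move=> /partition_bounds[h1 h2]; rewrite !(leq_trans _ kN).
by rewrite mulrA mulrC gauss_qf; apply: eqX_qf => //; lia.
Qed.

(** Multiplying all parts by 3 is a bijection. *)
Lemma p3_dil3 n : (p3 n)%:Z = fcoef (dil3 npart_gf) n.
Proof.
rewrite fcoef_dil3 /p3; set A := fset_set _.
have A_in s : (s \in A) = is_partition n s && all (dvdn 3) s.
  rewrite in_fset_set; last by apply: sub_finite_set (finite_partitions n) => t [].
  by apply/idP/andP; rewrite inE.
case: ifP => [/dvdnP[m nm]|n3]; last first.
  suff -> : A = fset0 by rewrite cardfs0.
  apply/fsetP => s; rewrite A_in inE; apply/negP => /andP[/and3P[_ _ /eqP sn] s3].
  move/negP: n3; apply; rewrite -sn sumnE big_seq.
  by apply: dvdn_sum => x; exact: (allP s3).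
rewrite nm mulnK // -[RHS]/(npart m) /npart big_const_seq count_predT iter_addr_0 natz.
congr Posz; rewrite -(size_map (map (muln 3)) (partitions m)); apply: perm_size.
have inj3 : injective (muln 3) by move=> x y /eqP; rewrite eqn_pmul2l // => /eqP.
apply: uniq_perm; first exact: fset_uniq.
  by rewrite map_inj_uniq ?fset_uniq //; exact: inj_map.
have mapP3 s : is_partition (m * 3) (map (muln 3) s) = is_partition m s.
  rewrite /is_partition sorted_map all_map; congr [&& _, _ & _].
  - by apply: eq_sorted => x y /=; rewrite leq_pmul2l.
  - by apply: eq_all => x /=; rewrite muln_gt0.
  - by rewrite -[RHS](eqn_pmul2r (isT : 0 < 3)%N); congr (_ == _);
    elim: s => //= x s ->; lia.
move=> s; rewrite A_in nm; apply/andP/mapP => [[sn s3]|[t]].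
  have sE : s = map (muln 3) (map (divn^~ 3) s).
    rewrite -map_comp -[LHS]map_id; apply/eq_in_map => x xs /=.
    by rewrite mulnC divnK //; exact: (allP s3).
  by exists (map (divn^~ 3) s) => //; rewrite in_partitions -mapP3 -sE.
rewrite in_partitions -mapP3 => tm ->; split => //.
by rewrite all_map; apply/allP => x _ /=; exact: dvdn_mulr.
Qed.

Lemma qinf3_npart : qinf3 * dil3 npart_gf = 1.
Proof.
apply: fpsP => k; have := @dil3_eqX k _ _ (@npart_eqX k).
rewrite rmorphM rmorph1 /= => <- //; apply: eqXM (leqnn k) => //.
apply: eqX_trans (@qinf3_eqX k k.+1 _) _ => //.
by apply: dil3_eqX; apply: eqX_qf.
Qed.

Definition rank_ge_gf (m : nat) : fps int := Fps (rank_ge m).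

Lemma rank_ge_gf_rec m :
  rank_ge_gf m.+1 = q ^+ m.+2 * (npart_gf - rank_ge_gf (m.+1 + 3)).
Proof.
apply: fpsP => n; rewrite fcoef_XnM fcoefD fcoefN.
by rewrite {1}/fcoef /= rank_ge_rec.
Qed.

(** The exponent collected by k steps of [rank_ge_gf_rec] from rank m: the sum of m + 1 + 3 j over j
    < k. *)
Definition dyson_exp (m k : nat) : nat := (m * k + 3 * 'C(k, 2) + k)%N.

Lemma dyson_expS m k : dyson_exp m.+1 k.+1 = (m.+2 + dyson_exp (m.+1 + 3) k)%N.
Proof. by rewrite /dyson_exp binS bin1; nia. Qed.

Lemma rank_ge_gf_eqX N K m : eqX N (qf N * rank_ge_gf m.+1)
  (\sum_(k < K) (-1) ^+ k * q ^+ dyson_exp m.+1 k.+1 +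
   (-1) ^+ K * q ^+ dyson_exp m.+1 K * (qf N * rank_ge_gf (m.+1 + 3 * K))).
Proof.
elim: K m => [|K IH] m.
  rewrite big_ord0 add0r muln0 addn0 /dyson_exp muln0 /= !expr0 !mul1r.
  exact: eqX_refl.
rewrite big_ord_recl /= expr0 mul1r rank_ge_gf_rec mulrCA mulrBr.
have := IH (m + 3)%N; rewrite -addSn => h.
apply: (@eqX_trans _ _ (q ^+ m.+2 * (1 - qf N * rank_ge_gf (m.+1 + 3)))).
  apply: eqXM => //; apply: eqXB => //; exact: npart_eqX.
apply: eqX_trans (eqXM (@eqX_refl _ _) (eqXB (@eqX_refl _ _) h)) _.
rewrite (_ : (m.+1 + 3 + 3 * K = m.+1 + 3 * K.+1)%N); last lia.
have -> : dyson_exp m.+1 1 = m.+2 by rewrite /dyson_exp bin_small //; lia.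
rewrite [X in eqX _ _ (_ + X + _)](_ : _ =
    - (q ^+ m.+2 * \sum_(k < K) (-1) ^+ k * q ^+ dyson_exp (m.+1 + 3) k.+1)).
  by rewrite dyson_expS [(-1) ^+ K.+1]exprS exprD => k _; congr (fcoef _ k); ring.
rewrite mulr_sumr -sumrN; apply: eq_bigr => i _.
by rewrite /bump /= add1n dyson_expS [(-1) ^+ i.+1]exprS exprD; ring.
Qed.

Definition half_N2_gf : fps int := Fps half_N2.

(** The truncation of sum_m (2 m + 1) x^m = (1 + x) / (1 - x)^2, with its boundary terms. *)
Lemma sum_odd_pow (x : fps int) M :
  (1 - x) ^+ 2 * \sum_(m < M) fpsC (2 * m + 1)%N%:Z * x ^+ m =
  1 + x - fpsC (2 * M + 1)%N%:Z * x ^+ M + fpsC (2 * M%:Z - 1) * x ^+ M.+1.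
Proof.
have E k : fpsC (2 * k + 1)%N%:Z = 2 * k%:R + 1 by rewrite fpsC_nat natrD natrM.
have E' k : fpsC (2 * k%:Z - 1) = 2 * k%:R - 1.
  by rewrite rmorphB rmorphM /= !fpsC_nat rmorph1.
elim: M => [|M IH]; first by rewrite big_ord0 mulr0 E E' expr0 expr1; ring.
by rewrite big_ord_recr /= mulrDr IH !E !E' -[M.+1%:R]natr1 !exprS; ring.
Qed.

Lemma half_N2_eqX N :
  eqX N (qf N * half_N2_gf) (- \sum_(1 <= m < N.+1) rank_term m).
Proof.
have H0 : eqX N half_N2_gf
    (\sum_(m < N.+1) fpsC (2 * m + 1)%N%:Z * rank_ge_gf m.+1).
  (* The terms added for k <= m <= N vanish: a partition of k has rank less than k. *)
  move=> k kN; rewrite fcoef_sum {1}/fcoef /= /half_N2.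
  rewrite (big_ord_widen N.+1 (fun m => (2 * m + 1)%N%:Z * rank_ge m.+1 k));
    last by lia.
  rewrite big_mkcond; apply: eq_bigr => m _; rewrite fcoefCM.
  case: ifP => // mk;
    rewrite {1}/fcoef /= rank_ge_rec (_ : (_ < k)%N = false) ?mulr0 //.
  by lia.
apply: eqX_trans (eqXM (@eqX_refl _ _) H0) _; rewrite mulr_sumr.
(* The inner sum after exchanging m and k, since [dyson_exp m.+1 k.+1] = [dyson_exp 1 k.+1] + (k +
   1) m. *)
pose S (k : nat) : fps int := \sum_(m < N.+1) fpsC (2 * m + 1)%N%:Z * (q ^+ k.+1) ^+ m.
apply: (@eqX_trans _ _ (\sum_(k < N) (-1) ^+ k * q ^+ dyson_exp 1 k.+1 * S k)).
  apply: (@eqX_trans _ _ (\sum_(m < N.+1) fpsC (2 * m + 1)%N%:Z *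
     \sum_(k < N) (-1) ^+ k * q ^+ dyson_exp m.+1 k.+1)).
    apply: eqX_sum => m _ _; rewrite mulrCA; apply: eqXM => //.
    (* This kills both the last summand k = N and the remainder of N + 1 iterations. *)
    have dN : (N < dyson_exp m.+1 N.+1)%N by rewrite /dyson_exp; nia.
    apply: eqX_trans (@rank_ge_gf_eqX N N.+1 m) _.
    rewrite big_ord_recr /= -[X in eqX _ _ X]addr0 -addrA; apply: eqXD => //.
    rewrite -[X in eqX _ _ X]addr0; apply: eqXD.
      by rewrite mulrC; apply: eqX_XnM0.
    by rewrite -mulrA mulrCA; apply: eqX_XnM0.
  under eq_bigr => m _ do rewrite mulr_sumr.
  rewrite exchange_big /=; apply: eqX_sum => k _ _; rewrite mulr_sumr.
  apply: eqX_sum => m _ _ j _; congr (fcoef _ j); rewrite mulrCA -mulrA;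
    congr (_ * _).
  rewrite mulrCA -exprM -exprD; congr (_ * _ ^+ _); rewrite /dyson_exp; lia.
rewrite big_add1 big_mkord -sumrN; apply: eqX_sum => k _ _.
have U : (1 - q ^+ k.+1) ^+ 2 \is a GRing.unit by rewrite unitrX // unit_1X.
apply: (eqX_mulI U); rewrite mulrCA /S sum_odd_pow.
rewrite mulrN /rank_term [_ ^+ 2 * _]mulrC divrK //.
have -> : q ^+ rank_exp k.+1 = q ^+ dyson_exp 1 k.+1.
  have C2 : (2 * 'C(k.+1, 2) = k.+1 * k)%N.
    by elim: (nat_of_ord k) => // j IH; rewrite binS bin1 mulnDr IH; lia.
  by congr (_ ^+ _); rewrite /rank_exp /dyson_exp; nia.
rewrite [X in eqX _ _ X](_ : _ = (-1) ^+ k * q ^+ dyson_exp 1 k.+1 * (1 + q ^+ k.+1));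
  last by rewrite [(-1) ^+ k.+1]exprS; ring.
apply: eqXM => //.
(* The boundary terms of [sum_odd_pow] are divisible by q^((k+1)(N+1)). *)
rewrite -[X in eqX _ _ X]addr0 -addrA; apply: eqXD => //.
rewrite -[X in eqX _ _ X](addr0 0); apply: eqXD; [rewrite -[X in eqX _ _ X]oppr0; apply: eqXN|];
 by rewrite -exprM mulrC; apply: eqX_XnM0; nia.
Qed.

(** * Representations by x^2 + xy + y^2 *)

Definition chi3 (d : nat) : int :=
  if (d %% 3 == 1)%N then 1 else if (d %% 3 == 2)%N then -1 else 0.

Lemma chi3M a b : chi3 (a * b) = chi3 a * chi3 b.
Proof.
rewrite /chi3 -modnMm.
have := ltn_pmod a (isT : 0 < 3)%N; have := ltn_pmod b (isT : 0 < 3)%N.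
by case: (a %% 3)%N => [|[|[|]]] //; case: (b %% 3)%N => [|[|[|]]].
Qed.

Definition chi3_sum (n : nat) : int := \sum_(d <- divisors n) chi3 d.

Lemma sum_divisors_dvd (F : nat -> int) p n : (0 < p)%N -> (0 < n)%N ->
  \sum_(d <- divisors (p * n) | (p %| d)%N) F d =
  \sum_(e <- divisors n) F (p * e)%N.
Proof.
move=> p0 n0; rewrite -big_filter -[RHS](big_map (muln p) xpredT F).
apply: perm_big; apply: uniq_perm.
- by rewrite filter_uniq // divisors_uniq.
- rewrite map_inj_uniq ?divisors_uniq // => x y /eqP.
  by rewrite eqn_pmul2l // => /eqP.
move=> d; rewrite mem_filter -dvdn_divisors ?muln_gt0 ?p0 //.
apply/andP/mapP => [[/dvdnP[e ->]]|[e]].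
  rewrite mulnC dvdn_pmul2l // => en.
  by exists e => //; rewrite -dvdn_divisors.
by rewrite -dvdn_divisors // => en ->; rewrite dvdn_mulr // dvdn_pmul2l.
Qed.

(** The divisors of p n divisible by p contribute chi(p) times the sum for n. The others are the
    divisors of n prime to p, that is, all divisors of n less those divisible by p. *)
Lemma chi3_sum_prime p n : prime p -> (0 < n)%N ->
  chi3_sum (p * n) = (1 + chi3 p) * chi3_sum n -
    chi3 p * (if (p %| n)%N then chi3_sum (n %/ p) else 0).
Proof.
move=> pp n0; have p0 := prime_gt0 pp.
have dvdS m : (0 < m)%N -> \sum_(d <- divisors (p * m) | (p %| d)%N) chi3 d =
    chi3 p * chi3_sum m.
  move=> m0; rewrite sum_divisors_dvd // /chi3_sum mulr_sumr.
  by apply: eq_bigr => e _; rewrite chi3M.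
have -> : chi3 p * (if (p %| n)%N then chi3_sum (n %/ p) else 0) =
    \sum_(d <- divisors n | (p %| d)%N) chi3 d.
  case: ifP => [/dvdnP[m nm]|pn].
    move: n0; rewrite nm muln_gt0 => /andP[m0 _].
    by rewrite mulnK // mulnC dvdS.
  rewrite big_seq_cond big1 ?mulr0 // => d /andP[]; rewrite -dvdn_divisors //.
  by move=> dn pd; rewrite (dvdn_trans pd dn) in pn.
rewrite {1}/chi3_sum (bigID (fun d => (p %| d)%N)) /= dvdS //.
rewrite mulrDl mul1r addrC -addrA addrCA [LHS]addrC; congr (_ + _).
rewrite /chi3_sum [in RHS](bigID (fun d => (p %| d)%N)) /= addrAC subrr add0r.
rewrite -big_filter -[RHS]big_filter; apply: perm_big; apply: uniq_perm.
- by rewrite filter_uniq // divisors_uniq.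
- by rewrite filter_uniq // divisors_uniq.
move=> d; rewrite !mem_filter -!dvdn_divisors ?muln_gt0 ?p0 //.
case: (boolP (p %| d)%N) => //= pd; rewrite Gauss_dvdr //.
by rewrite coprime_sym prime_coprime.
Qed.

(* Pairs of integers [(x, y)] stand for [x + y e] with [e ^ 2 = e - 1], the
   Eisenstein integers, so that [x ^ 2 + x y + y ^ 2] is the norm. *)
Definition enorm (z : int * int) : int := z.1 ^+ 2 + z.1 * z.2 + z.2 ^+ 2.
Definition emul (z w : int * int) : int * int :=
  (z.1 * w.1 - z.2 * w.2, z.1 * w.2 + z.2 * w.1 + z.2 * w.2).
Definition econj (z : int * int) : int * int := (z.1 + z.2, - z.2).

Lemma enormM z w : enorm (emul z w) = enorm z * enorm w.
Proof. by rewrite /enorm /emul /=; ring. Qed.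

Lemma enorm_conj z : enorm (econj z) = enorm z.
Proof. by rewrite /enorm /econj /=; ring. Qed.

Lemma emulA z w t : emul z (emul w t) = emul (emul z w) t.
Proof. by rewrite /emul /=; congr pair; ring. Qed.

Lemma emulC z w : emul z w = emul w z.
Proof. by rewrite /emul /=; congr pair; ring. Qed.

Lemma emul_conj z : emul z (econj z) = (enorm z, 0).
Proof. by rewrite /emul /econj /enorm /=; congr pair; ring. Qed.

Lemma emul_int z (n : int) : emul z (n, 0) = (n * z.1, n * z.2).
Proof. by rewrite /emul /=; congr pair; ring. Qed.

Lemma enorm_ge0 z : 0 <= enorm z.
Proof.
case: z => x y; rewrite /enorm /=.
by have := sqr_ge0 (x + y); have := sqr_ge0 x; have := sqr_ge0 y; nra.
Qed.

Lemma emulIr w : enorm w != 0 -> injective (emul^~ w).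
Proof.
move=> w0 z z' /(congr1 (emul^~ (econj w))) /=.
rewrite -!emulA emul_conj !emul_int => -[/(mulfI w0) e1 /(mulfI w0) e2].
by case: z z' e1 e2 => [? ?] [? ?] /= -> ->.
Qed.

Definition eis_set (n : nat) : {fset int * int} :=
  fset_set [set z | enorm z = n%:Z]%classic.

Lemma finite_eis (n : nat) : finite_set [set z | enorm z = n%:Z]%classic.
Proof.
have := finite_image (fun t : int * int * int * int => (t.1.1.1, t.1.1.2))
  (finite_quadruples n).
apply: sub_finite_set => -[x y] /= h; exists (x, y, 0, 0) => //=.
by rewrite -h /enorm /=; ring.
Qed.

Lemma in_eis n z : (z \in eis_set n) = (enorm z == n%:Z).
Proof.
rewrite in_fset_set; last exact: finite_eis.
by apply/idP/eqP; rewrite inE.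
Qed.

Definition r2 (n : nat) : nat := #|` eis_set n|.

Lemma r2_1 : r2 1 = 6.
Proof.
rewrite /r2; set s := [:: (1, 0); (0, 1); (-1, 0); (0, -1); (1, -1); (-1, 1)] : seq (int * int).
rewrite -[RHS]/(size s); apply: perm_size; apply: uniq_perm => // -[x y].
rewrite in_eis; apply/eqP/idP; last first.
  by rewrite !inE => /or3P[||/or4P[|||]] /eqP[-> ->].
rewrite /enorm /= => h.
(* Four times the norm is 3 x^2 + (x + 2 y)^2. *)
have x2 : 3 * x ^+ 2 <= 4 by have := sqr_ge0 (x + 2%:Z * y); nra.
have y2 : 3 * y ^+ 2 <= 4 by have := sqr_ge0 (y + 2%:Z * x); nra.
have bnd (t : int) : 3 * t ^+ 2 <= 4 -> t = -1 \/ t = 0 \/ t = 1.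
  move=> t2; have [t0|t0] : t <= - 2 \/ -1 <= t by lia.
    by exfalso; nra.
  have [t1|t1] : 2 <= t \/ t <= 1 by lia.
    by exfalso; nra.
  by lia.
have [hx|[hx|hx]] := bnd x x2.
all: have [hy|[hy|hy]] := bnd y y2.
all: by move: h; rewrite hx hy.
Qed.

Lemma dvdz_primeM p x y : prime p ->
  (p%:Z %| x * y)%Z = (p%:Z %| x)%Z || (p%:Z %| y)%Z.
Proof. by move=> pp; rewrite !dvdzE abszM Euclid_dvdM. Qed.

Lemma dvd_enorm_snd p z : prime p -> (p%:Z %| enorm z)%Z -> (p%:Z %| z.2)%Z ->
  (p%:Z %| z.1)%Z.
Proof.
move=> pp pz p2; have : (p%:Z %| z.1 * z.1)%Z.
  have -> : z.1 * z.1 = enorm z - z.2 * (z.1 + z.2) by rewrite /enorm; ring.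
  by rewrite rpredB // dvdz_mulr.
by rewrite dvdz_primeM // orbb.
Qed.

Lemma emul_image p w n : enorm w = p%:Z -> (0 < p)%N ->
  #|` [fset emul z w | z in eis_set n]%fset| = r2 n.
Proof.
move=> wp p0; apply: card_imfset; apply: emulIr; rewrite wp; lia.
Qed.

(** z is a multiple of w exactly when p = w conj(w) divides z conj(w). Testing the second coordinate
    suffices, by [dvd_enorm_snd]. *)
Lemma mem_emul_image p w n z : enorm w = p%:Z -> prime p ->
  (z \in [fset emul t w | t in eis_set n]%fset) =
  (z \in eis_set (p * n)) && (p%:Z %| (emul z (econj w)).2)%Z.
Proof.
move=> wp pp; have p0 : p%:Z != 0 by have := prime_gt0 pp; lia.
apply/imfsetP/andP => [[t tn zE]|[]].
  have {zE}-> : z = emul t w by [].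
  rewrite in_eis enormM wp -emulA emul_conj emul_int wp /= dvdz_mulr //.
  by move: tn; rewrite in_eis => /eqP ->; rewrite mulrC PoszM eqxx.
rewrite in_eis => /eqP zn p2.
have p1 : (p%:Z %| (emul z (econj w)).1)%Z.
  by apply: dvd_enorm_snd => //; rewrite enormM zn PoszM -mulrA dvdz_mulr.
case/dvdzP: p1 => a ea; case/dvdzP: p2 => b eb.
have e : emul z (econj w) = (p%:Z * a, p%:Z * b).
  by rewrite [LHS]surjective_pairing ea eb ![_ * p%:Z]mulrC.
exists (a, b) => /=.
  rewrite in_eis; apply/eqP; apply: (mulfI p0); apply: (mulfI p0).
  have := congr1 enorm e; rewrite enormM zn enorm_conj wp PoszM => h.
  transitivity (enorm (p%:Z * a, p%:Z * b)); last by rewrite -h; ring.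
  by rewrite /enorm /=; ring.
have := congr1 (emul^~ w) e; rewrite /= -emulA (emulC _ w) emul_conj wp emul_int.
have -> : emul (p%:Z * a, p%:Z * b) w = (p%:Z * (emul (a, b) w).1, p%:Z * (emul (a, b) w).2).
  by rewrite /emul /=; congr pair; ring.
case=> /(mulfI p0) e1 /(mulfI p0) e2.
by rewrite [z]surjective_pairing e1 e2.
Qed.

Lemma mem_scale_image p n z : (0 < p)%N ->
  (z \in [fset emul t (p%:Z, 0) | t in eis_set n]%fset) =
  [&& z \in eis_set (p * p * n), (p%:Z %| z.1)%Z & (p%:Z %| z.2)%Z].
Proof.
move=> p_gt0; have p0 : p%:Z != 0 by lia.
apply/imfsetP/and3P => [[t tn zE]|[]].
  have {zE}-> : z = emul t (p%:Z, 0) by [].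
  rewrite in_eis enormM emul_int !dvdz_mulr //.
  by move: tn; rewrite in_eis => /eqP ->; rewrite !PoszM; split=> //; apply/eqP;
    rewrite /enorm /=; ring.
case: z => x y /=; rewrite in_eis => /eqP zn /dvdzP[a xa] /dvdzP[b yb].
exists (a, b) => /=; last by rewrite emul_int /= xa yb ![_ * p%:Z]mulrC.
rewrite in_eis; apply/eqP; apply: (mulfI p0); apply: (mulfI p0).
transitivity (enorm (x, y)); last by rewrite zn !PoszM; ring.
by rewrite /enorm /= xa yb; ring.
Qed.

Lemma r2_scale p n : (0 < p)%N ->
  #|` [fset emul z (p%:Z, 0) | z in eis_set n]%fset| = r2 n.
Proof.
move=> p0; apply: card_imfset; apply: emulIr; rewrite /enorm /=; nia.
Qed.

Lemma subr_cube (R : comNzRingType) (x y : R) :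
  x ^+ 3 - y ^+ 3 = (x - y) * (x ^+ 2 + x * y + y ^+ 2).
Proof. by ring. Qed.

(** In F_p, X^3 = Y^3. As Z = Z^p = (Z^3)^(p/3) Z^2 with p/3 rounded down, a nonzero Z is determined
    by its cube, so nonzero X and Y are equal. Then 3 Y^2 = 0, although p is not 3. *)
Lemma dvd_enorm_inert p z : prime p -> (p %% 3 = 2)%N ->
  (p%:Z %| enorm z)%Z -> (p%:Z %| z.1)%Z && (p%:Z %| z.2)%Z.
Proof.
move=> pp p2; have chp : p \in [pchar 'F_p] by exact: pchar_Fp.
case: z => x y /=;
  rewrite !(dvdz_pcharf chp) /enorm /= !rmorphD !rmorphXn rmorphM /=.
set X := x%:~R; set Y := y%:~R => /eqP h.
have expp (Z : 'F_p) : Z ^+ (3 * (p %/ 3) + 2) = Z.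
  rewrite (_ : 3 * (p %/ 3) + 2 = p)%N; last by lia.
  by rewrite -[in RHS](expf_card Z) card_Fp.
have XY3 : X ^+ 3 = Y ^+ 3.
  by apply/eqP; rewrite -subr_eq0 subr_cube h mulr0.
have := expp X; rewrite exprD exprM XY3; have := expp Y; rewrite exprD exprM.
set a := _ ^+ (p %/ 3) => eY eX.
have [Y0|Y0] := eqVneq Y 0.
  by move: h; rewrite Y0 mulr0 expr0n !addr0 => /eqP; rewrite expf_eq0 /= => ->.
have [X0|X0] := eqVneq X 0.
  by move: h; rewrite X0 mul0r expr0n !add0r => /eqP; rewrite expf_eq0 (negPf Y0).
have aY : a * Y = 1 by apply: (mulIf Y0); rewrite mul1r -mulrA -expr2.
have aX : a * X = 1 by apply: (mulIf X0); rewrite mul1r -mulrA -expr2.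
have a0 : a != 0 by apply/eqP => a0; move: aY; rewrite a0 mul0r => /eqP;
  rewrite eq_sym oner_eq0.
have XYe : X = Y by apply: (mulfI a0); rewrite aX aY.
move: h; rewrite XYe (_ : _ + _ = 3%:R * Y ^+ 2); last by rewrite -expr2; ring.
move/eqP; rewrite mulf_eq0 expf_eq0 /= (negPf Y0) orbF -(dvdn_pcharf chp).
by rewrite dvdn_prime2 // => /eqP p3; rewrite p3 in p2.
Qed.

Lemma r2_inert p n : prime p -> (p %% 3 = 2)%N -> (0 < n)%N ->
  r2 (p * n) = if (p %| n)%N then r2 (n %/ p) else 0%N.
Proof.
move=> pp p2 n0.
have dvd z := @dvd_enorm_inert p z pp p2.
rewrite /r2; case: ifP => [/dvdnP[m nm]|pn].
  rewrite nm mulnK ?prime_gt0 // -/(r2 m) -(@r2_scale p) ?prime_gt0 //.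
  congr (#|` _|); apply/fsetP => z; rewrite mem_scale_image ?prime_gt0 //.
  rewrite (mulnC m) mulnA; case: (boolP (z \in _)) => //=.
  rewrite in_eis => /eqP zn; rewrite dvd // zn -mulnA PoszM dvdz_mulr //.
apply/eqP; rewrite cardfs_eq0; apply/eqP/fsetP => z; rewrite in_eis !inE.
apply/negP => /eqP zn; have : (p%:Z %| enorm z)%Z by rewrite zn PoszM dvdz_mulr.
move=> /dvd /andP[/dvdzP[a xa] /dvdzP[b yb]].
have : (p%:Z * p%:Z %| p%:Z * n%:Z)%Z.
  rewrite -PoszM -zn /enorm xa yb; apply/dvdzP; exists (a ^+ 2 + a * b + b ^+ 2);
    ring.
rewrite dvdz_mul2l; last by have := prime_gt0 pp; lia.
by move=> h; have : (p %| n)%N := h; rewrite pn.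
Qed.

(** The element 1 + e has norm 3 and divides everything of norm divisible by 3, because (x + 2 y)^2
    is congruent to the norm modulo 3. *)
Lemma r2_3 n : r2 (3 * n) = r2 n.
Proof.
have w3 : enorm (1, 1) = 3%N%:Z by [].
rewrite -(@emul_image 3 (1, 1) n) // /r2; congr (#|` _|).
apply/fsetP => z; rewrite (mem_emul_image _ _ w3) //.
apply/esym; apply: andb_idr; rewrite in_eis => /eqP zn.
have : (3%N%:Z %| (z.1 + 2 * z.2) * (z.1 + 2 * z.2))%Z.
  have -> : (z.1 + 2 * z.2) * (z.1 + 2 * z.2) = enorm z + 3%N%:Z * (z.1 * z.2 + z.2 ^+ 2).
    by rewrite /enorm; ring.
  by rewrite zn PoszM rpredD // dvdz_mulr.
rewrite dvdz_primeM // orbb => h.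
have -> : (emul z (econj (1, 1))).2 = 3%N%:Z * z.2 - (z.1 + 2 * z.2).
  by rewrite /emul /econj /=; ring.
by rewrite rpredB // dvdz_mulr.
Qed.

(** Inclusion and exclusion: an element of norm p n is a multiple of w or of conj(w), and of both
    exactly when it is a multiple of p. *)
Lemma r2_split p w n : prime p -> (p %% 3 = 1)%N -> enorm w = p%:Z ->
  (0 < n)%N ->
  (r2 (p * n) + (if (p %| n)%N then r2 (n %/ p) else 0) = 2 * r2 n)%N.
Proof.
move=> pp p1 wp n0; have p0 := prime_gt0 pp.
have cp : enorm (econj w) = p%:Z by rewrite enorm_conj.
have pz0 : p%:Z != 0 by lia.
have p2 : ~~ (p%:Z %| 2)%Z.
  rewrite dvdzE /=; apply/negP => /dvdn_leq h; have := prime_gt1 pp; have := h isT;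
    lia.
have p3 : ~~ (p%:Z %| 3)%Z.
  rewrite dvdzE /=; apply/negP => /dvdn_leq h; have := prime_gt1 pp.
  by have := h isT; lia.
have pw2 : ~~ (p%:Z %| w.2)%Z.
  apply/negP => h2; have h1 : (p%:Z %| w.1)%Z by apply: dvd_enorm_snd => //;
    rewrite wp.
  case/dvdzP: h1 => a ea; case/dvdzP: h2 => b eb.
  have : p%:Z * (p%:Z * (a ^+ 2 + a * b + b ^+ 2)) = p%:Z * 1.
    by rewrite mulr1 -[RHS]wp /enorm ea eb; ring.
  move/(mulfI pz0) => h; have : (p%:Z %| 1%R)%Z by rewrite -h dvdz_mulr.
  by rewrite dvdzE /= dvdn1 => /eqP pe; rewrite pe in pp.
have pw1 : ~~ (p%:Z %| 2 * w.1 + w.2)%Z.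
  apply/negP => h; have : (p%:Z %| 3 * (w.2 * w.2))%Z.
    have -> : 3 * (w.2 * w.2) = 4 * enorm w - (2 * w.1 + w.2) * (2 * w.1 + w.2).
      by rewrite /enorm; ring.
    by rewrite wp; apply: rpredB; [exact: dvdz_mull|exact: dvdz_mulr].
  by rewrite !dvdz_primeM // (negPf p3) (negPf pw2).
pose A := [fset emul z w | z in eis_set n]%fset.
pose B := [fset emul z (econj w) | z in eis_set n]%fset.
have cc : econj (econj w) = w by case: (w) => a b; rewrite /econj /= opprK addrK.
have Ain z : (z \in A) = (z \in eis_set (p * n)) && (p%:Z %| (emul z (econj w)).2)%Z.
  exact: mem_emul_image.
have Bin z : (z \in B) = (z \in eis_set (p * n)) && (p%:Z %| (emul z w).2)%Z.
  by rewrite (mem_emul_image _ _ cp) // cc.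
have AUB : eis_set (p * n) = (A `|` B)%fset.
  apply/fsetP => z; rewrite in_fsetU Ain Bin -andb_orr.
  apply/esym; apply: andb_idr; rewrite in_eis => /eqP zn; rewrite -dvdz_primeM //.
  (* The product of the two test coordinates is divisible by p, hence so is one of them. *)
  have -> : (emul z (econj w)).2 * (emul z w).2 =
      z.2 * z.2 * enorm w - w.2 * w.2 * enorm z by rewrite /emul /econj /enorm /=;
        ring.
  rewrite zn wp PoszM; apply: rpredB; first exact: dvdz_mull.
  by apply: dvdz_mull; exact: dvdz_mulr.
have -> : (if (p %| n)%N then r2 (n %/ p) else 0)%N = #|` (A `&` B)%fset|.
  have ABin z : (z \in (A `&` B)%fset) =
      [&& z \in eis_set (p * n), (p%:Z %| z.1)%Z & (p%:Z %| z.2)%Z].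
    rewrite in_fsetI Ain Bin andbACA andbb; congr (_ && _).
    apply/andP/andP => [[h1 h2]|[/dvdzP[a ea] /dvdzP[b eb]]]; last first.
      rewrite /emul /econj /= ea eb; split; apply/dvdzP.
        by exists (a * - w.2 + b * (w.1 + w.2) + b * - w.2); ring.
      by exists (a * w.2 + b * w.1 + b * w.2); ring.
    (* The sum of the two test coordinates gives p | z.2, and then their difference gives p |
       z.1. *)
    have hy : (p%:Z %| z.2)%Z.
      have : (p%:Z %| z.2 * (2 * w.1 + w.2))%Z.
        have -> : z.2 * (2 * w.1 + w.2) = (emul z (econj w)).2 + (emul z w).2.
          by rewrite /emul /econj /=; ring.
        by rewrite rpredD.
      by rewrite dvdz_primeM // (negPf pw1) orbF.
    split=> //; have : (p%:Z %| w.2 * (2 * z.1))%Z.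
      have -> : w.2 * (2 * z.1) = (emul z w).2 - (emul z (econj w)).2 - w.2 * z.2.
        by rewrite /emul /econj /=; ring.
      by rewrite rpredB ?rpredB // dvdz_mull.
    by rewrite !dvdz_primeM // (negPf pw2) (negPf p2).
  case: ifP => [/dvdnP[m nm]|pn].
    rewrite nm mulnK // -(@r2_scale p) //; congr (#|` _|); apply/fsetP => z.
    by rewrite ABin mem_scale_image // nm (mulnC m) mulnA.
  apply/esym/eqP; rewrite cardfs_eq0; apply/eqP/fsetP => z; rewrite ABin in_eis inE.
  apply/negP => /and3P[/eqP zn /dvdzP[a xa] /dvdzP[b yb]].
  have : (p%:Z * p%:Z %| p%:Z * n%:Z)%Z.
    by rewrite -PoszM -zn /enorm xa yb; apply/dvdzP;
      exists (a ^+ 2 + a * b + b ^+ 2); ring.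
  by rewrite dvdz_mul2l // => h; have : (p %| n)%N := h; rewrite pn.
rewrite /r2 AUB cardfsUI [#|` A|](emul_image n wp) // [#|` B|](emul_image n cp) //.
by rewrite mul2n addnn.
Qed.

Lemma exists_sqrt_floor p : exists s, (s ^ 2 <= p < s.+1 ^ 2)%N.
Proof.
elim: p => [|p [s /andP[h1 h2]]]; first by exists 0%N.
have [h|h] := ltnP p.+1 (s.+1 ^ 2); first by exists s; rewrite h andbT leqW.
by exists s.+1; rewrite h /=; nia.
Qed.

(** The polynomial X^k - 1 with k = (p - 1) / 3 has too few roots to vanish on all nonzero x; if x^k
    is not 1, it is a nontrivial cube root of 1. *)
Lemma exists_cube_root_Fp p : prime p -> (p %% 3 = 1)%N ->
  exists t : 'F_p, t ^+ 2 + t + 1 = 0.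
Proof.
move=> pp p1; pose k := (p %/ 3)%N.
have pE : p.-1 = (3 * k)%N by rewrite /k; lia.
have k0 : (0 < k)%N by have := prime_gt1 pp; rewrite /k; lia.
have cardp : #|'F_p| = p by exact: card_Fp.
have [x x0 xk] : exists2 x : 'F_p, x != 0 & x ^+ k != 1.
  have [/existsP[x /andP[x0 xk]]|/existsPn h] :=
    boolP [exists x : 'F_p, (x != 0) && (x ^+ k != 1)]; first by exists x.
  exfalso; pose P : {poly 'F_p} := 'X^k - 1.
  have Psz : size P = k.+1 by rewrite size_XnsubC.
  have P0 : P != 0 by rewrite -size_poly_eq0 Psz.
  have := @max_poly_roots _ P (enum [pred x : 'F_p | x != 0]) P0.
  rewrite enum_uniq Psz -cardE => /(_ _ isT).
  have -> : all (root P) (enum [pred x : 'F_p | x != 0]).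
    apply/allP => x; rewrite mem_enum inE => x0.
    have := h x; rewrite x0 /= negbK => /eqP xk.
    by rewrite /root !hornerE xk subrr.
  move=> /(_ isT).
  have -> : #|[pred x : 'F_p | x != 0]| = p.-1.
    have := cardC1 (0 : 'F_p); rewrite cardp => <-.
    by apply: eq_card => x; rewrite !inE.
  by rewrite pE; lia.
exists (x ^+ k); have t3 : (x ^+ k) ^+ 3 = 1.
  rewrite -exprM mulnC -pE; apply: (mulIf x0); rewrite mul1r -exprSr.
  by rewrite prednK ?prime_gt0 // -[in RHS](expf_card x) cardp.
have := subr_cube (x ^+ k) 1; rewrite t3 !expr1n mulr1 subrr => /esym/eqP.
by rewrite mulf_eq0 subr_eq0 (negPf xk) => /eqP.
Qed.

(** Thue's argument yields a nonzero pair below sqrt(p) with x = t y modulo p. Its norm is a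
    multiple of p below 3 p; the value 2 p is excluded, since 2 is inert and 4 would divide it. *)
Lemma exists_enorm_prime p : prime p -> (p %% 3 = 1)%N ->
  exists w, enorm w = p%:Z.
Proof.
move=> pp p1; have [t t3] := exists_cube_root_Fp pp p1.
have [s /andP[s1 s2]] := exists_sqrt_floor p.
have sp : (s ^ 2 < p)%N.
  rewrite ltn_neqAle s1 andbT; apply/eqP => sp.
  by have := lognX p s 2; rewrite sp logn_prime // eqxx; lia.
(* Thue's pigeonhole argument. *)
pose f (z : 'I_s.+1 * 'I_s.+1) : 'F_p := z.1%:R - t * z.2%:R.
have /injectivePn[z [z' zz' fz]] : ~~ injectiveb f.
  apply/injectiveP => /leq_card; rewrite card_prod card_ord card_Fp //.
  by move: s2; rewrite expnS expn1; lia.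
pose x : int := z.1%:Z - z'.1%:Z; pose y : int := z.2%:Z - z'.2%:Z.
have xy : x%:~R = t * y%:~R :> 'F_p.
  have -> : x%:~R = z.1%:R - z'.1%:R :> 'F_p by rewrite /x rmorphB.
  have -> : y%:~R = z.2%:R - z'.2%:R :> 'F_p by rewrite /y rmorphB.
  apply/eqP; rewrite -subr_eq0; move/eqP: fz; rewrite /f -subr_eq0.
  by congr (is_true (_ == 0)); ring.
have pn : (p%:Z %| enorm (x, y))%Z.
  rewrite (dvdz_pcharf (pchar_Fp pp)) /enorm /= !rmorphD !rmorphXn rmorphM /= xy.
  set Y : 'F_p := y%:~R.
  have -> : (t * Y) ^+ 2 + t * Y * Y + Y ^+ 2 = Y ^+ 2 * (t ^+ 2 + t + 1) by ring.
  by rewrite t3 mulr0.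
have xs : (`|x| <= s)%N by rewrite /x; have := ltn_ord z.1; have := ltn_ord z'.1;
  lia.
have ys : (`|y| <= s)%N by rewrite /y; have := ltn_ord z.2; have := ltn_ord z'.2;
  lia.
have nz : enorm (x, y) != 0.
  apply/eqP => n0; have : x = 0 /\ y = 0.
    have h1 := sqr_ge0 (x + y); have h2 := sqr_ge0 x; have h3 := sqr_ge0 y.
    move: n0; rewrite /enorm /= => n0.
    have x2 : x ^+ 2 = 0 by nra.
    have y2 : y ^+ 2 = 0 by nra.
    by move/eqP: x2; move/eqP: y2; rewrite !expf_eq0 /= => /eqP -> /eqP ->.
  move=> [hx hy]; case/negP: zz'; apply/eqP.
  have e1 : z.1 = z'.1 by apply: val_inj; move/eqP: hx;
    rewrite /x subr_eq0 => /eqP[].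
  have e2 : z.2 = z'.2 by apply: val_inj; move/eqP: hy;
    rewrite /y subr_eq0 => /eqP[].
  by rewrite [z]surjective_pairing [z']surjective_pairing e1 e2.
(* Twice the norm is 3 (x^2 + y^2) - (x - y)^2. *)
have nlt : enorm (x, y) < 3 * p%:Z.
  have x2 : x ^+ 2 <= (s ^ 2)%N%:Z by rewrite expnS expn1 PoszM; nia.
  have y2 : y ^+ 2 <= (s ^ 2)%N%:Z by rewrite expnS expn1 PoszM; nia.
  by have := sqr_ge0 (x - y); rewrite /enorm /=; nia.
case/dvdzP: pn => k ek; have n0 := enorm_ge0 (x, y).
have kE : k = 1 \/ k = 2.
  by move: nz nlt n0; rewrite ek; have := prime_gt0 pp; nia.
case: kE => k12; first by exists (x, y); rewrite ek k12 mul1r.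
exfalso; have e2 : (2%N%:Z %| enorm (x, y))%Z by rewrite ek k12 dvdz_mulr.
have /andP[x2 y2] := @dvd_enorm_inert 2 (x, y) isT erefl e2.
case/dvdzP: x2 => a xa; case/dvdzP: y2 => b yb.
have : 2 * p%:Z = 4 * (a ^+ 2 + a * b + b ^+ 2).
  by rewrite -k12 -ek /enorm xa yb /=; ring.
move=> h; have : (2 %| p)%N by move: (a ^+ 2 + a * b + b ^+ 2) h => c h; lia.
by rewrite dvdn_prime2 // => /eqP p2; rewrite -p2 in p1.
Qed.

(** Removing the least prime factor p, both sides obey the same recurrence, whether p is 3, split or
    inert; for n = 1 there are six units. *)
Lemma r2_chi3_sum n : (0 < n)%N -> (r2 n)%:Z = 6 * chi3_sum n.
Proof.
elim/ltn_ind: n => n IH n0; have [->|n1] := eqVneq n 1%N.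
  by rewrite r2_1 /chi3_sum big_seq1.
have n1' : (1 < n)%N by lia.
have pp := pdiv_prime n1'; set p := pdiv n in pp; have p0 := prime_gt0 pp.
have /dvdnP[m nm] := pdiv_dvd n; rewrite -/p mulnC in nm.
have p1 := prime_gt1 pp.
have m0 : (0 < m)%N by move: n0; rewrite nm muln_gt0 => /andP[].
have mn : (m < n)%N by nia.
have IHm := IH m mn m0.
have IHp : (p %| m)%N -> (r2 (m %/ p))%:Z = 6 * chi3_sum (m %/ p).
  move=> pm; apply: IH; last by rewrite divn_gt0 // dvdn_leq.
  by apply: leq_ltn_trans mn; exact: leq_div.
rewrite nm chi3_sum_prime //.
have [p3|[p3|p3]] : (p %% 3 = 0 \/ p %% 3 = 1 \/ p %% 3 = 2)%N by lia.
- have -> : chi3 p = 0 by rewrite /chi3 p3.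
  have -> : p = 3%N.
    apply/eqP; rewrite eq_sym -dvdn_prime2 //; apply/dvdnP; exists (p %/ 3)%N; lia.
  by rewrite r2_3 IHm; ring.
- have [w wp] := exists_enorm_prime pp p3.
  have -> : chi3 p = 1 by rewrite /chi3 p3.
  have := r2_split pp p3 wp m0; case: ifP => [/IHp e|_] h; lia.
- have -> : chi3 p = -1 by rewrite /chi3 p3.
  by rewrite r2_inert //; case: ifP => [/IHp ->|_]; lia.
Qed.

(** * Squaring the Lambert series of the cubic character *)

Definition lam (n : nat) : fps int := q ^+ n / (1 - q ^+ n).

Lemma lambertP (n : nat) (f g : fps int) : (0 < n)%N ->
  (forall k, fcoef f k = fcoef g k + if (n <= k)%N then fcoef f (k - n) else 0) ->
  f = g / (1 - q ^+ n).
Proof.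
move=> n0 fg; apply: (mulIr (unit_1X n0)); rewrite divrK ?unit_1X //.
apply: fpsP => k; rewrite mulrBr mulr1 [f * _]mulrC fcoefD fcoefN fcoef_XnM {1}fg.
by rewrite addrK.
Qed.

Lemma fcoef_lam n k : (0 < n)%N ->
  fcoef (lam n) k = ((0 < k) && (n %| k))%N%:R.
Proof.
move=> n0; pose f : fps int := Fps (fun k => ((0 < k) && (n %| k))%N%:R).
rewrite /lam -(@lambertP n f) // => j; rewrite fcoef_Xn /f /fcoef /=.
have [nj|nj] := leqP n j; last first.
  rewrite addr0; congr (_%:R); case: j nj => [|j] nj.
    by rewrite /= (_ : 0 == n = false)%N //; apply/eqP; lia.
  rewrite /= (_ : _ == _ = false); last by apply/eqP; lia.
  by rewrite gtnNdvd.
have -> : (n %| j)%N = (n %| j - n)%N by rewrite dvdn_subl.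
have -> : (0 < j)%N by lia.
have [->|jn] := eqVneq j n; first by rewrite subnn dvdn0 addr0.
by rewrite add0r subn_gt0 ltn_neqAle eq_sym jn nj.
Qed.

Lemma fcoef_lam2 n k : (0 < n)%N ->
  fcoef (q ^+ n / (1 - q ^+ n) ^+ 2) k = if (n %| k)%N then (k %/ n)%N%:Z else 0.
Proof.
move=> n0;
  pose f : fps int := Fps (fun k => if (n %| k)%N then (k %/ n)%N%:Z else 0).
have U := unit_1X n0.
have -> : q ^+ n / (1 - q ^+ n) ^+ 2 = lam n / (1 - q ^+ n).
  by rewrite expr2 invrM // mulrA.
rewrite -(@lambertP n f) // => j; rewrite fcoef_lam // /f /fcoef /=.
have [nj|nj] := leqP n j; last first.
  rewrite addr0; case: j nj => [|j] nj; first by rewrite dvdn0 div0n.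
  by case: ifP => // /dvdn_leq; lia.
have -> : (0 < j)%N by lia.
have -> : (n %| j - n)%N = (n %| j)%N by rewrite dvdn_subl.
case: ifP => // /dvdnP[[|m] jm]; first by move: nj; rewrite jm leqNgt n0.
by rewrite jm mulSn addKn mulnK // addnC divnDr // divnn n0 mulnK // addn1; lia.
Qed.

(** With a = q^m and b = q^n, this is 1 - a b = (1 - a) (1 - b) + a (1 - b) + b (1 - a). *)
Lemma lamM m n : (0 < m)%N -> (0 < n)%N ->
  lam m * lam n = lam (m + n) * (1 + lam m + lam n).
Proof.
move=> m0 n0; rewrite /lam exprD.
have mn0 : (0 < m + n)%N by lia.
have Ua := unit_1X m0; have Ub := unit_1X n0; have Uc := unit_1X mn0.
move: Ua Ub Uc; rewrite exprD; set a := q ^+ m; set b := q ^+ n => Ua Ub Uc.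
have eA := mulVr Ua; have eB := mulVr Ub; have eC := mulVr Uc.
move: eA eB eC; set A := (1 - a)^-1; set B := (1 - b)^-1; set C := (1 - a * b)^-1.
move=> eA eB eC.
transitivity (a * b * (A * B) * (C * (1 - a * b))); first by rewrite eC; ring.
have -> : 1 + a * A + b * B = A * (B * (1 - b)) + b * B * (A * (1 - a)).
  by rewrite eB eA -[X in X + _ + _]eA; ring.
by ring.
Qed.

Lemma lam_sqr n : (0 < n)%N -> lam n ^+ 2 = q ^+ n / (1 - q ^+ n) ^+ 2 - lam n.
Proof.
move=> n0; have U := unit_1X n0; rewrite /lam.
move: U; set a := q ^+ n => U; have eA := mulVr U.
rewrite expr2 [X in _ = a / X - _]expr2 invrM //.
move: eA; set A := (1 - a)^-1 => eA.
have -> : a * (A * A) - a * A = a * A * (A - A * (1 - a)) by rewrite eA; ring.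
by ring.
Qed.

Lemma lam_eqX0 N n : (N < n)%N -> eqX N (lam n) 0.
Proof. by move=> Nn; exact: eqX_XnM0. Qed.

Lemma sum_divisors_nat N k (F : nat -> int) : (0 < k)%N -> (k <= N)%N ->
  \sum_(1 <= n < N.+1 | (n %| k)%N) F n = \sum_(d <- divisors k) F d.
Proof.
move=> k0 kN; rewrite -big_filter; apply: perm_big; apply: uniq_perm.
- by rewrite filter_uniq // iota_uniq.
- exact: divisors_uniq.
move=> d; rewrite mem_filter mem_index_iota -dvdn_divisors //.
case: (boolP (d %| k)%N) => //= dk.
by rewrite (dvdn_gt0 k0 dk) ltnS (leq_trans (dvdn_leq k0 dk)).
Qed.

(** Both sides have coefficients sigma(k): each divisor d is exchanged with k / d. *)
Lemma lambert_swap N :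
  eqX N (\sum_(1 <= n < N.+1) q ^+ n / (1 - q ^+ n) ^+ 2)
        (\sum_(1 <= n < N.+1) fpsC n%:Z * lam n).
Proof.
move=> k kN; rewrite !fcoef_sum.
transitivity (\sum_(1 <= n < N.+1 | (n %| k)%N) (k %/ n)%N%:Z).
  by rewrite [RHS]big_mkcond; apply: eq_big_nat => n /andP[n0 _];
    rewrite fcoef_lam2.
transitivity (\sum_(1 <= n < N.+1 | (n %| k)%N && (0 < k)%N) n%:Z); last first.
  rewrite [LHS]big_mkcond; apply: eq_big_nat => n /andP[n0 _].
  by rewrite fcoefCM fcoef_lam // andbC; case: ifP; rewrite ?mulr1 ?mulr0.
have [->|k0] := posnP k.
  rewrite big1 => [|n _]; last by rewrite div0n.
  by rewrite big_pred0 // => n; rewrite andbF.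
under [RHS]eq_bigl do rewrite andbT.
rewrite !sum_divisors_nat // -(big_map (fun d => (k %/ d)%N) xpredT (fun n => n%:Z)).
apply: perm_big; apply: uniq_perm; rewrite ?divisors_uniq //.
  rewrite map_inj_in_uniq ?divisors_uniq // => d e.
  rewrite -!dvdn_divisors // => dk ek h.
  by rewrite -[d](mulKn _ k0) -(divnA _ dk) h divnA // mulKn.
move=> d; rewrite -dvdn_divisors //; apply/mapP/idP => [[e]|dk].
  by rewrite -dvdn_divisors // => /dvdn_div ek ->.
exists (k %/ d)%N; last by rewrite divnA // mulKn.
by rewrite -dvdn_divisors // dvdn_div.
Qed.

(** 2 cos(2 pi k / 3). *)
Definition cos3 (k : nat) : int := if (3 %| k)%N then 2 else -1.

(** The rule 4 sin A sin B = 2 cos(A - B) - 2 cos(A + B), with chi(m) = (2 / sqrt 3) sin(2 pi m / 3)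
    and m + 2 n in place of m - n. *)
Lemma chi3_cos3 m n : 3 * (chi3 m * chi3 n) = cos3 (m + 2 * n) - cos3 (m + n).
Proof.
rewrite /chi3 /cos3 /dvdn -(modnDm m (2 * n)) -(modnMm 2 n) -(modnDm m n).
have := ltn_pmod m (isT : 0 < 3)%N; have := ltn_pmod n (isT : 0 < 3)%N.
by case: (m %% 3)%N => [|[|[|]]] //; case: (n %% 3)%N => [|[|[|]]].
Qed.

Lemma sum_square (R : comNzRingType) N (F : nat -> nat -> R) :
  \sum_(1 <= m < N.+1) \sum_(1 <= n < N.+1) F m n =
  \sum_(1 <= m < N.+1) F m m +
  \sum_(1 <= n < N.+1) \sum_(1 <= m < n) (F m n + F n m).
Proof.
elim: N => [|N IH]; first by rewrite !big_geq // addr0.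
rewrite big_nat_recr //= [in RHS]big_nat_recr //= [X in _ = _ + X]big_nat_recr //=.
under eq_bigr => m _ do rewrite big_nat_recr //=.
rewrite big_split /= IH [X in _ + X = _]big_nat_recr //= big_split /=.
by ring.
Qed.

Lemma sum_convolution N (F : nat -> nat -> fps int) :
  (forall m n, (0 < m)%N -> (0 < n)%N -> (N < m + n)%N -> eqX N (F m n) 0) ->
  eqX N (\sum_(1 <= m < N.+1) \sum_(1 <= n < N.+1) F m n)
        (\sum_(1 <= k < N.+1) \sum_(1 <= m < k) F m (k - m)%N).
Proof.
move=> F0; apply: (@eqX_trans _ _ (\sum_(1 <= m < N.+1)
    \sum_(1 <= n < N.+1) if (m + n <= N)%N then F m n else 0)).
  rewrite big_nat_cond [X in eqX _ _ X]big_nat_cond.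
  apply: eqX_sum => m _ /andP[/andP[m0 mN] _].
  rewrite big_nat_cond [X in eqX _ _ X]big_nat_cond.
  apply: eqX_sum => n _ /andP[/andP[n0 nN] _].
  by case: leqP => // mn; exact: F0.
rewrite [X in eqX _ _ X](_ : _ = \sum_(1 <= m < N.+1)
    \sum_(1 <= n < N.+1) if (m + n <= N)%N then F m n else 0) //.
transitivity (\sum_(1 <= k < N.+1) \sum_(1 <= m < N.+1 | (m < k)%N) F m (k - m)%N).
  apply: eq_big_nat => k /andP[k0 kN];
    rewrite [RHS](eq_bigl (fun m => xpredT m && (m < k)%N)) //.
  by rewrite -big_nat_widen // ltnW.
rewrite (exchange_big_dep_nat xpredT) //=; apply: eq_big_nat => m /andP[m0 mN].
rewrite -(@big_nat_widenl _ _ _ m.+1 1 _ xpredT) // -add1n big_addn.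
rewrite (@big_nat_widen _ _ _ 1 (N.+1 - m) N.+1) /=;
  last by rewrite leq_subLR leq_addl.
rewrite [LHS]big_mkcond; apply: eq_bigr => n _; rewrite addnK.
by have -> : (n < N.+1 - m)%N = (m + n <= N)%N by lia.
Qed.

(* Ramanujan's computation of the square of a Lambert series: everything is
   expressed through [\sum_(m < n) cos3 m * lam m * lam n] and its variants by
   means of [lam m * lam n = lam (m + n) * (1 + lam m + lam n)]. *)
Section LambertSquare.
Variable N : nat.
Let c k : fps int := fpsC (cos3 k).
Let Sn (F : nat -> fps int) := \sum_(1 <= n < N.+1) F n.

(** Terms are collected by n, the sum of the two indices; [lamM] expands lam m lam (n - m), and its
    last two terms agree under m -> n - m. *)
Lemma cos3_plus :
  eqX N (Sn (fun m => Sn (fun n => c (m + n) * (lam m * lam n))))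
    (Sn (fun n => c n * (n.-1)%:R * lam n) +
     2 * Sn (fun n => \sum_(1 <= m < n) c n * (lam n * lam m))).
Proof.
rewrite /Sn;
  apply: eqX_trans (@sum_convolution N (fun m n => c (m + n) * (lam m * lam n)) _) _.
  move=> m n m0 n0 mn; rewrite lamM // mulrCA -[X in eqX _ _ X](mul0r (c (m + n)
    * (1 + lam m + lam n))).
  by apply: eqXM => //; exact: lam_eqX0.
rewrite mulr_sumr -big_split /= [X in eqX _ X _](_ : _ =
  \sum_(1 <= n < N.+1) (c n * n.-1%:R * lam n +
     2 * \sum_(1 <= m < n) c n * (lam n * lam m))) //.
apply: eq_big_nat => n /andP[n0 nN].
transitivity (\sum_(1 <= m < n) (c n * lam n + c n * (lam n * lam m) +
   c n * (lam n * lam (n - m)))).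
  apply: eq_big_nat => m /andP[m0 mn]; rewrite subnKC ?(ltnW mn) //.
  by rewrite lamM ?subn_gt0 // subnKC ?(ltnW mn) //; ring.
rewrite !big_split /= sumr_const_nat subn1 -mulr_natr.
rewrite [X in _ + X](_ : _ = \sum_(1 <= m < n) c n * (lam n * lam m));
  first by ring.
rewrite big_nat_rev /=; apply: eq_big_nat => m /andP[m0 mn].
by congr (_ * (_ * lam _)); lia.
Qed.

(** Off the diagonal, m -> n - m makes the weight c m, and [lamM] is solved for lam n lam (n - m).
    The convolution so created folds back into a full square sum. The remaining double sum is that
    of [cos3_plus], so it cancels in the difference. *)
Lemma cos3_minus :
  eqX N (Sn (fun m => Sn (fun n => c (m + 2 * n) * (lam m * lam n))))
    (Sn (fun n => (2 + 2 * c n) * lam n ^+ 2) +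
     2 * Sn (fun n => \sum_(1 <= m < n) c n * (lam n * lam m)) -
     2 * Sn (fun n => (\sum_(1 <= m < n) c m) * lam n)).
Proof.
rewrite /Sn sum_square.
have c3E a b : cos3 (a + 3 * b) = cos3 a by rewrite /cos3;
  congr (if _ then _ else _); lia.
rewrite (eq_bigr (fun m => 2 * lam m ^+ 2)) => [|m _]; last first.
  rewrite (_ : m + 2 * m = 0 + 3 * m)%N; last by lia.
  by rewrite /c c3E expr2 rmorph_nat.
have -> : \sum_(1 <= n < N.+1) \sum_(1 <= m < n)
      (c (m + 2 * n) * (lam m * lam n) + c (n + 2 * m) * (lam n * lam m)) =
    2 * (\sum_(1 <= n < N.+1) \sum_(1 <= m < n) c m * (lam m * lam (n - m)))
    - 2 * (\sum_(1 <= n < N.+1) \sum_(1 <= m < n) c m * (lam m * lam n))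
    - 2 * \sum_(1 <= n < N.+1) (\sum_(1 <= m < n) c m) * lam n.
  rewrite !mulr_sumr -!sumrB; apply: eq_big_nat => n /andP[n0 nN].
  transitivity (\sum_(1 <= m < n) 2 * (c (n - m) * (lam m * lam n))).
    apply: eq_big_nat => m /andP[m0 mn].
    rewrite /c (_ : cos3 (m + 2 * n) = cos3 (n - m)); last first.
      by rewrite /cos3; congr (if _ then _ else _); lia.
    rewrite (_ : cos3 (n + 2 * m) = cos3 (n - m)); last first.
      by rewrite /cos3; congr (if _ then _ else _); lia.
    by ring.
  rewrite big_nat_rev /= mulr_suml !mulr_sumr -!sumrB;
    apply: eq_big_nat => m /andP[m0 mn].
  rewrite !add1n !subSS subKn ?(ltnW mn) //.
  have := @lamM m (n - m) m0; rewrite subn_gt0 => /(_ mn);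
    rewrite subnKC ?(ltnW mn) // => ->.
  by ring.
apply: (@eqX_trans _ _ (\sum_(1 <= m < N.+1) 2 * lam m ^+ 2 +
    (2 * (\sum_(1 <= m < N.+1) \sum_(1 <= n < N.+1) c m * (lam m * lam n))
    - 2 * (\sum_(1 <= n < N.+1) \sum_(1 <= m < n) c m * (lam m * lam n))
    - 2 * \sum_(1 <= n < N.+1) (\sum_(1 <= m < n) c m) * lam n))).
  apply: eqXD => //; apply: eqXB => //; apply: eqXB => //; apply: eqXM => //.
  apply: eqX_sym; apply: (@sum_convolution N (fun m n => c m * (lam m * lam n))).
  move=> m n m0 n0 mn; rewrite lamM // mulrCA -[X in eqX _ _ X](mul0r (c m
    * (1 + lam m + lam n))).
  by apply: eqXM => //; exact: lam_eqX0.
rewrite sum_square => k _; congr (fcoef _ k).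
rewrite [\sum_(1 <= n < N.+1) (2 + 2 * c n) * _](_ : _ =
   \sum_(1 <= m < N.+1) 2 * lam m ^+ 2 + 2 * \sum_(1 <= m < N.+1) c m * (lam m * lam m)).
  rewrite [X in 2 * (_ + X)](_ : _ =
    \sum_(1 <= n < N.+1) \sum_(1 <= m < n) c m * (lam m * lam n) +
    \sum_(1 <= n < N.+1) \sum_(1 <= m < n) c n * (lam n * lam m)); first by ring.
  by rewrite -big_split; apply: eq_bigr => n _; rewrite -big_split.
by rewrite mulr_sumr -big_split; apply: eq_bigr => n _ /=; ring.
Qed.

End LambertSquare.

Lemma sum_dvd3_eqX N (F : nat -> fps int) :
  (forall n, (N < n)%N -> eqX N (F n) 0) ->
  eqX N (\sum_(1 <= m < N.+1) F (3 * m)%N)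
        (\sum_(1 <= n < N.+1) if (3 %| n)%N then F n else 0).
Proof.
move=> F0; pose G n := if (0 < n)%N then F n else 0.
have -> : \sum_(1 <= m < N.+1) F (3 * m)%N = \sum_(i < (3 * N).+1 | (3 %| i)%N) G i.
  rewrite sum_dvd3 -(big_mkord xpredT (fun m => G (3 * m)%N)) [RHS]big_ltn //.
  rewrite {1}/G muln0 /= add0r; apply: eq_big_nat => m /andP[m0 _].
  by rewrite /G muln_gt0 m0.
rewrite -(big_mkord (fun i => 3 %| i)%N G) [X in eqX _ X]big_mkcond /=.
rewrite [X in eqX _ X](@big_cat_nat _ _ _ N.+1) /=; [|lia|lia].
rewrite -[X in eqX _ _ X]addr0; apply: eqXD.
  rewrite [X in eqX _ X]big_ltn // [X in eqX _ (X + _)]/= add0r.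
  rewrite big_nat_cond [X in eqX _ _ X]big_nat_cond.
  by apply: eqX_sum => n _ /andP[/andP[n0 _] _]; rewrite /G n0.
rewrite [X in eqX _ _ X](_ : 0 = \sum_(N.+1 <= i < (3 * N).+1) 0);
  last by rewrite big1.
rewrite big_nat_cond [X in eqX _ _ X]big_nat_cond.
apply: eqX_sum => n _ /andP[/andP[Nn _] _]; case: ifP => // _.
by rewrite /G; case: ifP => // _; exact: F0.
Qed.

Lemma dil3_lam n : (0 < n)%N -> dil3 (lam n) = lam (3 * n).
Proof.
move=> n0; rewrite /lam rmorphM rmorphV ?unit_1X //.
by rewrite rmorphB rmorph1 /= dil3X.
Qed.

Lemma dil3_lam2 n : (0 < n)%N ->
  dil3 (q ^+ n / (1 - q ^+ n) ^+ 2) = q ^+ (3 * n) / (1 - q ^+ (3 * n)) ^+ 2.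
Proof.
move=> n0; rewrite rmorphM rmorphV ?unitrX ?unit_1X //= dil3X.
by rewrite rmorphXn rmorphB rmorph1 /= dil3X.
Qed.

Lemma lam2_dvd3_eqX N :
  eqX N (\sum_(1 <= n < N.+1) if (3 %| n)%N then q ^+ n / (1 - q ^+ n) ^+ 2 else 0)
        (\sum_(1 <= n < N.+1) if (3 %| n)%N then fpsC (n %/ 3)%N%:Z * lam n else 0).
Proof.
apply: (@eqX_trans _ _ (dil3 (\sum_(1 <= n < N.+1) q ^+ n / (1 - q ^+ n) ^+ 2))).
  rewrite rmorph_sum; apply: eqX_sym.
  rewrite (eq_big_nat _ _ (fun n H => dil3_lam2 (proj1 (andP H)))).
  by apply: (@sum_dvd3_eqX N (fun n => q ^+ n / (1 - q ^+ n) ^+ 2)) => n;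
    exact: eqX_XnM0.
apply: eqX_trans (dil3_eqX (@lambert_swap N)) _.
rewrite rmorph_sum.
rewrite (eq_big_nat _ _ (F2 := fun m => fpsC (3 * m %/ 3)%N%:Z * lam (3 * m))).
  apply: (@sum_dvd3_eqX N (fun n => fpsC (n %/ 3)%N%:Z * lam n)) => n Nn.
  by rewrite /lam mulrCA; exact: eqX_XnM0.
move=> m /andP[m0 _]; rewrite rmorphM /= dil3_lam // mulKn //; congr (_ * _).
by apply: fpsP => k; rewrite fcoef_dil3 /fcoef /=; case: ifP => [/dvdnP[j ->]|];
  [rewrite mulnK // muln_eq0 orbF|case: k].
Qed.

Lemma sum_cos3 n : \sum_(1 <= m < n.+1) cos3 m =
  if (n %% 3 == 0)%N then 0 else if (n %% 3 == 1)%N then -1 else - 2.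
Proof.
elim: n => [|n IH]; first by rewrite big_geq.
rewrite big_nat_recr //= IH /cos3 /dvdn -[n.+1]addn1 -(modnDml n 1).
by have := ltn_pmod n (isT : 0 < 3)%N; case: (n %% 3)%N => [|[|[|]]].
Qed.

Definition chi3_lambert (N : nat) : fps int :=
  \sum_(1 <= n < N.+1) fpsC (chi3 n) * lam n.
Definition sigma3_lambert (N : nat) : fps int :=
  \sum_(1 <= n < N.+1) if (3 %| n)%N then 0 else fpsC n%:Z * lam n.

(** Once the double sums cancel, only a combination of the lam n is left, compared for each residue
    of n modulo 3. *)
Lemma chi3_lambert_sqr N :
  eqX N (3 * chi3_lambert N ^+ 2) (sigma3_lambert N - chi3_lambert N).
Proof.
have := eqXB (@cos3_minus N) (@cos3_plus N) => h.
apply: (eqX_trans _ (eqX_trans h _)) => {h}.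
  move=> k _; congr (fcoef _ k);
    rewrite expr2 /chi3_lambert mulr_suml mulr_sumr -sumrB.
  apply: eq_bigr => m _; rewrite mulr_sumr mulr_sumr -sumrB; apply: eq_bigr => n _.
  have e := congr1 (@fpsC int) (chi3_cos3 m n); rewrite rmorphB /= in e.
  rewrite -[RHS]mulrBl -e; ring.
(* The weight 2 + 2 cos3 n is 6 or 0, so squares survive only for 3 | n; [lam_sqr] and
   [lam2_dvd3_eqX] make them linear in lam n. *)
apply: (@eqX_trans _ _ (6 * (\sum_(1 <= n < N.+1) if (3 %| n)%N then
     fpsC (n %/ 3)%N%:Z * lam n else 0)
   - 6 * (\sum_(1 <= n < N.+1) if (3 %| n)%N then lam n else 0)
   - \sum_(1 <= n < N.+1) fpsC (cos3 n) * n.-1%:R * lam n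
   - 2 * \sum_(1 <= n < N.+1) (\sum_(1 <= m < n) fpsC (cos3 m)) * lam n)).
  apply: (@eqX_trans _ _ (6 * (\sum_(1 <= n < N.+1) if (3 %| n)%N then
     q ^+ n / (1 - q ^+ n) ^+ 2 else 0)
   - 6 * (\sum_(1 <= n < N.+1) if (3 %| n)%N then lam n else 0)
   - \sum_(1 <= n < N.+1) fpsC (cos3 n) * n.-1%:R * lam n
   - 2 * \sum_(1 <= n < N.+1) (\sum_(1 <= m < n) fpsC (cos3 m)) * lam n)); last first.
    do 3!apply: eqXB => //; apply: eqXM => //; exact: lam2_dvd3_eqX.
  move=> k _; congr (fcoef _ k).
  rewrite [\sum_(1 <= n < N.+1) (2 + 2 * fpsC (cos3 n)) * _](_ : _ =
    6 * (\sum_(1 <= n < N.+1) if (3 %| n)%N then q ^+ n / (1 - q ^+ n) ^+ 2 else 0)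
    - 6 * (\sum_(1 <= n < N.+1) if (3 %| n)%N then lam n else 0)); first by ring.
  rewrite !mulr_sumr -sumrB; apply: eq_big_nat => n /andP[n0 _].
  rewrite /cos3; case: ifP => _; last by ring.
  by rewrite lam_sqr //; ring.
move=> k _; congr (fcoef _ k).
rewrite /sigma3_lambert /chi3_lambert !mulr_sumr -!sumrB.
apply: eq_big_nat => -[//|n] /andP[_ _].
rewrite -rmorph_sum sum_cos3 [n.+1.-1]/=.
have := ltn_pmod n (isT : 0 < 3)%N; have nE := divn_eq n 3.
rewrite fpsC_nat /cos3 /chi3 /dvdn -[n.+1]addn1 -(modnDml n 1).
case: (n %% 3)%N nE => [|[|[|]]] // nE _ /=.
- by rewrite fpsC_nat natrD rmorphN rmorph1 rmorph0; ring.
- by rewrite fpsC_nat natrD rmorphN rmorph1; ring.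
- move: nE; move: (n %/ 3)%N => j ->.
  rewrite (_ : (j * 3 + 2 + 1) %/ 3 = j.+1)%N; last lia.
  rewrite fpsC_nat [(j * 3 + 2)%:R]natrD natrM -[j.+1%:R]natr1 rmorphN rmorph0 rmorph_nat; ring.
Qed.

(** * Representations by the sum of two such forms *)

(** The generating function of the sum of divisors, by [lambert_swap]. *)
Definition sigma_gf : fps int :=
  fps_sum (fun n => q ^+ n / (1 - q ^+ n) ^+ 2).

Lemma sigma_gf_eqX N :
  eqX N sigma_gf (\sum_(1 <= n < N.+1) q ^+ n / (1 - q ^+ n) ^+ 2).
Proof.
move=> k kN; apply: fcoef_fps_sum => // n j jn.
exact: (@eqX_XnM0 j n).
Qed.

Lemma sigma3_lambert_eqX N :
  eqX N (sigma3_lambert N) (sigma_gf - 3 * dil3 sigma_gf).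
Proof.
have sE := eqX_trans (@sigma_gf_eqX N) (@lambert_swap N).
apply: eqX_sym; apply: (@eqX_trans _ _ (\sum_(1 <= n < N.+1) fpsC n%:Z * lam n -
   \sum_(1 <= n < N.+1) if (3 %| n)%N then fpsC n%:Z * lam n else 0)).
  apply: eqXB => //; apply: eqX_trans (eqXM (eqX_refl _) (dil3_eqX sE)) _.
  rewrite rmorph_sum mulr_sumr.
  rewrite (eq_big_nat _ _ (F2 := fun m => fpsC (3 * m)%N%:Z * lam (3 * m))).
    apply: (@sum_dvd3_eqX N (fun n => fpsC n%:Z * lam n)) => n Nn.
    by rewrite /lam mulrCA; exact: eqX_XnM0.
  move=> m /andP[m0 _]; rewrite rmorphM /= dil3_lam // mulrA; congr (_ * _).
  by rewrite !fpsC_nat rmorph_nat natrM.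
move=> k _; congr (fcoef _ k); rewrite /sigma3_lambert -sumrB.
by apply: eq_bigr => n _; case: ifP; rewrite ?subrr ?subr0.
Qed.

Definition r2_gf : fps int := Fps (fun n => (r2 n)%:Z).

Lemma r2_0 : r2 0 = 1%N.
Proof.
rewrite /r2 (_ : eis_set 0 = [fset (0, 0)]%fset) ?cardfs1 //.
apply/fsetP => -[x y]; rewrite in_eis inE; apply/eqP/eqP => [|[-> ->] //].
rewrite /enorm /= => h.
have h1 := sqr_ge0 (x + y); have h2 := sqr_ge0 x; have h3 := sqr_ge0 y.
have x2 : x ^+ 2 = 0 by nra.
have y2 : y ^+ 2 = 0 by nra.
by move/eqP: x2; move/eqP: y2; rewrite !expf_eq0 /= => /eqP -> /eqP ->.
Qed.

Lemma r2_gf_eqX N : eqX N r2_gf (1 + 6 * chi3_lambert N).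
Proof.
move=> k kN; rewrite fcoefD fcoef1 {1}/fcoef /=.
rewrite -(fpsC_nat 6) fcoefCM /chi3_lambert fcoef_sum.
have [->|k0] := posnP k.
  rewrite r2_0 big_nat_cond big1 ?mulr0 // => n /andP[/andP[n0 _] _].
  by rewrite fcoefCM fcoef_lam // mulr0.
rewrite r2_chi3_sum // add0r.
congr (_ * _); rewrite /chi3_sum -(@sum_divisors_nat N) // big_mkcond.
apply: eq_big_nat => n /andP[n0 _]; rewrite fcoefCM fcoef_lam // k0 /=.
by case: ifP; rewrite ?mulr1 ?mulr0.
Qed.

Lemma R4_conv (k : nat) :
  (R4 k)%:Z = \sum_(i < k.+1) (r2 i)%:Z * (r2 (k - i))%:Z.
Proof.
rewrite /R4; set A := fset_set _.
have Ain t : (t \in A) = (enorm (t.1.1.1, t.1.1.2) + enorm (t.1.2, t.2) == k%:Z).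
  rewrite in_fset_set; last exact: finite_quadruples.
  case: t => [[[x y] u] v]; rewrite /enorm /= !addrA eq_sym.
  by apply/idP/eqP; rewrite inE.
pose f (t : int * int * int * int) := `|enorm (t.1.1.1, t.1.1.2)|%N.
transitivity (\sum_(t <- A) (1 : int)).
  by rewrite big_const_seq count_predT iter_addr_0 natz.
rewrite (@sum_by_value _ f k); last first.
  move=> t; rewrite Ain /f => /eqP.
  have := enorm_ge0 (t.1.1.1, t.1.1.2); have := enorm_ge0 (t.1.2, t.2).
  by move: (enorm _) (enorm _); lia.
apply: eq_bigr => -[i /= ik] _; rewrite -PoszM -big_filter.
pose g (z w : int * int) := (z.1, z.2, w.1, w.2).
rewrite (perm_big [seq g z w | z <- eis_set i, w <- eis_set (k - i)]) /=.
  by rewrite big_const_seq count_predT iter_addr_0 natz size_allpairs.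
apply: uniq_perm; first by rewrite filter_uniq ?fset_uniq.
  rewrite allpairs_uniq ?fset_uniq // => -[[x y] [u v]] [[x' y'] [u' v']] _ _ /=.
  by rewrite /g /= => -[-> -> -> ->].
move=> [[[x y] u] v]; rewrite mem_filter Ain /f /=; apply/andP/allpairsP.
  move=> [/eqP xi /eqP xk]; exists ((x, y), (u, v)) => /=.
  have := enorm_ge0 (x, y); move: xi xk; rewrite !in_eis.
  by move: (enorm _) (enorm _) => s t si st s0; split=> //; lia.
move=> [[[x' y'] [u' v']] /=]; rewrite !in_eis => -[/eqP e1 /eqP e2].
rewrite /g /= => -[-> -> -> ->]; rewrite e1 e2; split=> //; lia.
Qed.

Definition R4_gf : fps int := Fps (fun n => (R4 n)%:Z).

Lemma R4_gfE : R4_gf = r2_gf ^+ 2.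
Proof.
by apply: fpsP => k; rewrite expr2 fcoefM /fcoef /= R4_conv.
Qed.

(** With L the Lambert series of chi, (1 + 6 L)^2 = 1 + 12 L + 12 (3 L^2), and [chi3_lambert_sqr]
    cancels the linear term. *)
Lemma R4_sigma : R4_gf = 1 + 12 * (sigma_gf - 3 * dil3 sigma_gf).
Proof.
apply: fpsP => k; rewrite R4_gfE.
have e : eqX k (r2_gf ^+ 2) ((1 + 6 * chi3_lambert k) ^+ 2).
  by rewrite !expr2; apply: eqXM; exact: r2_gf_eqX.
rewrite e // (_ : _ ^+ 2 = 1 + 12 * chi3_lambert k + 12 * (3 * chi3_lambert k ^+ 2)); last by ring.
apply: (@eqX_trans k _ (1 + 12 * chi3_lambert k + 12 * (sigma3_lambert k - chi3_lambert k))) => //.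
  by apply: eqXD => //; apply: eqXM => //; exact: chi3_lambert_sqr.
rewrite (_ : _ + _ = 1 + 12 * sigma3_lambert k); last by ring.
by apply: eqXD => //; apply: eqXM => //; exact: sigma3_lambert_eqX.
Qed.

Lemma P3E n : (P3 n)%:Z =
  12 * fcoef ((sigma_gf - 3 * dil3 sigma_gf) * dil3 npart_gf) n.
Proof.
set D := sigma_gf - _.
(* P_3 omits k = 0, just as D has no constant term. *)
have D0 : fcoef D 0 = 0.
  rewrite -(@sigma3_lambert_eqX 0) // /sigma3_lambert big_geq //.
have R4D k : (0 < k)%N -> (R4 k)%:Z = 12 * fcoef D k.
  move=> k0; have := congr1 (fun f => fcoef f k) R4_sigma.
  rewrite {1}/fcoef /= => ->;
    rewrite fcoefD fcoef1 (_ : (k == 0%N) = false) ?add0r; last by apply/eqP; lia.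
  by rewrite -(fpsC_nat 12) fcoefCM.
rewrite /P3 fcoefM big_ord_recl D0 mul0r add0r.
rewrite -[LHS]natz natr_sum big_add1 big_mkord mulr_sumr.
apply: eq_bigr => i _; rewrite natz PoszM p3_dil3 R4D // mulrA.
by [].
Qed.

Lemma spt23_gfE :
  spt23_gf = sigma_gf * dil3 npart_gf - dil3 half_N2_gf.
Proof.
apply: (mulrI qinf3_unit); rewrite mulrBr mulrCA qinf3_npart mulr1.
apply: fpsP => k; rewrite (@spt23_eqX k) //.
apply: (@eqX_trans k _ (sigma_gf - dil3 (qf k) * dil3 half_N2_gf)) => //.
  apply: eqXD; first by apply: eqX_sym; exact: sigma_gf_eqX.
  rewrite -rmorphM -rmorphN; apply: dil3_eqX; apply: eqX_sym.
  by rewrite -[X in eqX _ _ X]opprK; apply: eqXN; exact: half_N2_eqX.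
apply: eqXB => //; apply: eqXM => //; apply: eqX_sym.
apply: eqX_trans (@qinf3_eqX k k.+1 _) _ => //.
by apply: dil3_eqX; apply: eqX_qf.
Qed.

Theorem theorem3 :
  (forall n : nat, (1 <= n)%N ->
     exists a b : int,
       [/\ (a%:~R = (P3 (3 * n))%:R / 12%:R :> rat),
           (b%:~R = (N2 n)%:~R / 2%:R :> rat)
         & (spt23 (3 * n) = a - b %[mod 3])%Z])
  /\ (forall n : nat, (1 <= n)%N ->
        (n%:Z = 1 %[mod 3] \/ n%:Z = -1 %[mod 3])%Z ->
        ((spt23 n)%:~R = (P3 n)%:R / 12%:R :> rat)).
Proof.
pose a n := fcoef ((sigma_gf - 3 * dil3 sigma_gf) * dil3 npart_gf) n.
have aE n : (a n)%:~R = (P3 n)%:R / 12%:R :> rat.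
  have -> : (P3 n)%:R = (P3 n)%:Z%:~R :> rat by [].
  by rewrite P3E intrM mulrC mulKf.
(* The difference from P_3 / 12 is a series in q^3. Modulo 3 its sigma part drops out. *)
have sptE n : spt23 n = a n + (if (3 %| n)%N then
    3 * fcoef (sigma_gf * npart_gf) (n %/ 3) - half_N2 (n %/ 3) else 0).
  rewrite /spt23 spt23_gfE fcoefD fcoefN fcoef_dil3 /a.
  rewrite (_ : (sigma_gf - 3 * dil3 sigma_gf) * dil3 npart_gf =
    sigma_gf * dil3 npart_gf - 3 * dil3 (sigma_gf * npart_gf)); last first.
    by rewrite rmorphM /=; ring.
  rewrite fcoefD fcoefN -(fpsC_nat 3).
  rewrite fcoefCM fcoef_dil3; case: ifP => _; last by rewrite mulr0 oppr0 !addr0.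
  by rewrite -!addrA; congr (_ + _); rewrite addrA addNr add0r.
split=> n n1; last first.
  move=> h; have n3 : (3 %| n)%N = false by case: h; lia.
  by rewrite sptE n3 addr0 aE.
exists (a (3 * n)%N), (half_N2 n); split; first exact: aE.
  by rewrite N2E intrM mulrC mulKf.
rewrite sptE dvdn_mulr // mulKn // addrCA; apply/eqP.
by rewrite mulrC modzMDl.
Qed.
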